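(* Assume the asymptotic setting below together with conditions (A1)–(A3). Then $$\frac{|\hat a_S-a^*|}{n}\to0\quad\text{almost surely as }n\to\infty.$$
   Context: Asymptotic setting. For each $n$, let $p=p_n$ and let $\Psi=\Psi_n$ be a $p\times p$ positive definite matrix. Let $Y$ be a $p\times(n-1)$ random matrix with i.i.d. columns distributed as $\mathcal N_p(0,\Psi)$, and $W=YY^\top$. (This arises from the Bayesian model $x_i\mid\theta_i\sim\mathcal N_p(\theta_i,I_p)$, $\theta_i\mid\mu\sim\mathcal N_p(\mu,\Lambda)$, $\mu$ flat on $\mathbb R^p$, with $\Psi=I_p+\Lambda$ and $W=(X-\bar X)(X-\bar X)^\top$.) Let $\hat\alpha\ge0$ be a scalar statistic (function of $W$), $c_0\ge0$ a fixed constant, $V=(W+\hat\alpha I_p)^{-1}$, and define $$\hat a_S=\frac{(n-p-1)\mathrm{tr}(V)+\hat\alpha(\mathrm{tr}V)^2}{\mathrm{tr}(V^2W)}-(2c_0+1),\qquad a^*=\frac{\mathrm{tr}(\Psi^{-1})-\hat\alpha\,\mathrm{tr}(V\Psi^{-1})}{\mathrm{tr}(V^2W)}.$$ ($a^*$ minimizes over $a$ the loss $\frac1{np}\mathrm{tr}\{(aV-\Psi^{-1})^2W\}$.) Conditions: (A1) $n/p\to\gamma$ as $n\to\infty$, where $0<\gamma<\infty$ and $\gamma\ne1$. (A2) There are constants $0<c_1\le c_2$ such that all eigenvalues $\tau_1,\dots,\tau_p$ of $\Psi$ lie in $[c_1,c_2]$ for all $n$, and the empirical spectral distribution $H_p(\tau)=p^{-1}\sum_{j=1}^p1_{[\tau_j,\infty)}(\tau)$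 converges to a nonrandom probability distribution $H$. (A3) $\hat\alpha/n\to\alpha$ almost surely as $n\to\infty$, for some constant $\alpha>0$. *)

(* Defs.v *)
From HB Require Import structures.
From mathcomp Require Import all_boot all_order all_algebra.
From mathcomp Require Import all_classical all_reals all_analysis.
From mathcomp Require Import normal_distribution.
Set Implicit Arguments. Unset Strict Implicit. Unset Printing Implicit Defensive.
Import Order.TTheory GRing.Theory Num.Theory.
Import numFieldNormedType.Exports.
Local Open Scope classical_set_scope.
Local Open Scope ring_scope.

Definition posdef {R : realType} (p : nat) (A : 'M[R]_p) : Prop :=
  A^T = A /\ forall x : 'cV[R]_p, x != 0 -> 0 < (x^T *m A *m x) 0 0.

Definition has_normal_law {R : realType} d (T : measurableType d)
  (P : probability T R) (X : T -> R) (m v : R) : Prop :=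
  measurable_fun setT X /\
  forall A : set R, measurable A ->
    P (X @^-1` A) = normal_prob m (Num.sqrt v) A.

Definition has_mvnormal0_law {R : realType} d (T : measurableType d)
  (P : probability T R) (p : nat) (X : T -> 'cV[R]_p) (Psi : 'M[R]_p) : Prop :=
  forall v : 'cV[R]_p, v != 0 ->
    has_normal_law P (fun w => (v^T *m X w) 0 0) 0 ((v^T *m Psi *m v) 0 0).

Definition indep_vectors {R : realType} d (T : measurableType d)
  (P : probability T R) (p m : nat) (X : 'I_m -> T -> 'cV[R]_p) : Prop :=
  forall t : 'I_m -> 'cV[R]_p,
    P [set w | forall j i, (X j w i ord0 <= t j i ord0)%R] =
    (\prod_(j < m) P [set w | forall i, (X j w i ord0 <= t j i ord0)%R])%E.

Definition iid_mvnormal0_columns {R : realType} d (T : measurableType d)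
  (P : probability T R) (p m : nat) (Y : T -> 'M[R]_(p, m)) (Psi : 'M[R]_p) : Prop :=
  indep_vectors P (fun j w => col j (Y w)) /\
  forall j : 'I_m, has_mvnormal0_law P (fun w => col j (Y w)) Psi.

Definition is_distribution_function {R : realType} (H : R -> R) : Prop :=
  {homo H : x y / x <= y} /\
  (forall t : R, (H x @[x --> t^'+] --> H t)) /\
  (H x @[x --> -oo] --> (0:R)) /\
  (H x @[x --> +oo] --> (1:R)).

Definition esd {R : realType} (p : nat) (tau : 'I_p -> R) (t : R) : R :=
  (\sum_(j < p) (tau j <= t)%R%:R) / p%:R.

Definition Vmat {R : realType} (p : nat) (W : 'M[R]_p) (alpha : R) : 'M[R]_p :=
  invmx (W + alpha%:M).

Definition a_S {R : realType} (n p : nat) (c0 : R) (W : 'M[R]_p) (alpha : R) : R :=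
  let V := Vmat W alpha in
  ((n%:R - p%:R - 1) * \tr V + alpha * (\tr V) ^+ 2) / \tr (V *m V *m W)
  - (2 * c0 + 1).

Definition a_star {R : realType} (p : nat) (Psi W : 'M[R]_p) (alpha : R) : R :=
  let V := Vmat W alpha in
  (\tr (invmx Psi) - alpha * \tr (V *m invmx Psi)) / \tr (V *m V *m W).

(* Main.v *)
Require Import Defs.
From HB Require Import structures.
From mathcomp Require Import all_boot all_order all_algebra.
From mathcomp Require Import all_classical all_reals all_analysis.
From mathcomp Require Import sesquilinear spectral mxpoly complex.
From mathcomp Require Import normal_distribution measurable_realfun zify ring lra.
Import Order.TTheory GRing.Theory Num.Theory.
Import numFieldNormedType.Exports.
Local Open Scope classical_set_scope.
Local Open Scope ring_scope.

(* Let V = (W + a I)^{-1}, and let V_j be V with the column y_j removed from W.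
   As tr(VW) = p - a tr V and V y_j = w_j V_j y_j with the leave-one-out weight
   w_j = 1 - y_j^T V y_j in (0, 1], the numerator of a_S + (2 c0 + 1) - a_star is
     D(a) = sum_j w_j (tr V - y_j^T Psi^{-1} V_j y_j).
   By the rank-one update tr V differs from tr V_j by at most 1/a, and y_j is
   independent of V_j, so that y_j^T Psi^{-1} V_j y_j - tr V_j is a centred
   Gaussian quadratic form; by Stein's identity its fourth moment is O(n^{-2})
   when a = n alpha.  Fourth moments are thus summable, and D(n alpha) = o(n)
   almost surely.  The resolvent identity bounds |D(a) - D(n alpha)| by a
   constant times |a - n alpha|, uniformly in a >= n alpha / 2, which replaces
   n alpha by the W-dependent alphahat.  Finally tr(V^2 W) stays bounded away
   from 0: if it were small, Cauchy-Schwarz would make tr(VW) and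
   sum_j y_j^T Psi^{-1} V y_j small compared to n, contradicting D(a) = o(n)
   because tr V is bounded below. *)

(** * Euclidean vectors and coercive matrices *)

(** Two features of the hypotheses shape the proof. Normality is given through the scalar laws of
    [v^T X], [v != 0]. Stein's identity is therefore first proved for powers of one linear form, by
    scalar integration by parts, and then polarized: expectations that are polynomial in a parameter
    may be compared coefficient by coefficient. Independence is given through joint distribution
    functions, so it is extended from orthants to the sigma-algebras of the columns; Tonelli then
    freezes the other columns while [y_j] is integrated. Freezing requires a deterministic shift in
    [V_j], which is why [n alpha] comes first: alphahat depends on [y_j] too. Almost sure
    convergence is drawn from summability in n alone. The second moment of a fluctuation is only of
    order 1/n, which does not sum; the fourth gives n^-2. Everything after the moment bounds is
    deterministic, for a fixed sample and large n, and uses operator-norm bounds of the form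
    [nrm (A *m x) <= k * nrm x]. *)

Section EuclideanVectors.
Context {R : realType} {p : nat}.
Implicit Types (u v x : 'cV[R]_p) (A M : 'M[R]_p).

Definition dot u v : R := (u^T *m v) 0 0.
Definition nrm u : R := Num.sqrt (dot u u).

Lemma dotE u v : dot u v = \sum_i u i 0 * v i 0.
Proof. by rewrite /dot mxE; apply: eq_bigr => i _; rewrite mxE. Qed.

Lemma dotC u v : dot u v = dot v u.
Proof. by rewrite !dotE; apply: eq_bigr => i _; rewrite mulrC. Qed.

Lemma dotDl u v x : dot (u + v) x = dot u x + dot v x.
Proof. by rewrite /dot linearD mulmxDl mxE. Qed.

Lemma dotDr u v x : dot u (v + x) = dot u v + dot u x.
Proof. by rewrite /dot mulmxDr mxE. Qed.

Lemma dotZl c u v : dot (c *: u) v = c * dot u v.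
Proof. by rewrite /dot linearZ -scalemxAl mxE. Qed.

Lemma dotZr c u v : dot u (c *: v) = c * dot u v.
Proof. by rewrite /dot -scalemxAr mxE. Qed.

Lemma dotNr u v : dot u (- v) = - dot u v.
Proof. by rewrite -scaleN1r dotZr mulN1r. Qed.

Lemma dotNl u v : dot (- u) v = - dot u v.
Proof. by rewrite -scaleN1r dotZl mulN1r. Qed.

Lemma dotBr u v x : dot u (v - x) = dot u v - dot u x.
Proof. by rewrite dotDr dotNr. Qed.

Lemma dotBl u v x : dot (u - v) x = dot u x - dot v x.
Proof. by rewrite dotDl dotNl. Qed.

Lemma dot0l v : dot 0 v = 0.
Proof. by rewrite -(scale0r (0 : 'cV[R]_p)) dotZl mul0r. Qed.

Lemma dot0r v : dot v 0 = 0.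
Proof. by rewrite dotC dot0l. Qed.

Lemma dot_mulmxr u A v : dot u (A *m v) = dot (A^T *m u) v.
Proof. by rewrite /dot trmx_mul trmxK mulmxA. Qed.

Lemma dot_ge0 u : 0 <= dot u u.
Proof. by rewrite dotE sumr_ge0 // => i _; rewrite -expr2 sqr_ge0. Qed.

Lemma dot_eq0 u : (dot u u == 0) = (u == 0).
Proof.
apply/eqP/eqP => [|->]; last by rewrite dot0l.
rewrite dotE => /psumr_eq0P u0; apply/matrixP => i j; rewrite ord1 mxE.
by apply/eqP; rewrite -sqrf_eq0 expr2 u0 // => k _; rewrite -expr2 sqr_ge0.
Qed.

Lemma sqr_nrm u : nrm u ^+ 2 = dot u u.
Proof. by rewrite sqr_sqrtr // dot_ge0. Qed.

Lemma nrm_ge0 u : 0 <= nrm u. Proof. exact: sqrtr_ge0. Qed.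

Lemma dot_le_nrm u v : `|dot u v| <= nrm u * nrm v.
Proof.
rewrite -ler_sqr ?nnegrE ?mulr_ge0 ?nrm_ge0 // exprMn !sqr_nrm real_normK ?num_real //.
have [/eqP|v0] := eqVneq (dot v v) 0.
  by rewrite dot_eq0 => /eqP ->; rewrite !dot0r mulr0 expr0n.
have v_gt0 : 0 < dot v v by rewrite lt_def v0 dot_ge0.
have := dot_ge0 (dot v v *: u - dot u v *: v).
rewrite !(dotBl, dotBr, dotZl, dotZr) (dotC v u) => h.
rewrite -subr_ge0 -(pmulr_rge0 _ v_gt0); apply: le_trans h _.
by rewrite le_eqVlt; apply/orP; left; apply/eqP; ring.
Qed.

Lemma trace_dot A : \tr A = \sum_i dot (delta_mx i 0) (A *m delta_mx i 0).
Proof.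
apply: eq_bigr => i _.
by rewrite /dot trmx_delta -rowE -colE !mxE.
Qed.

Lemma nrm_delta i : nrm (delta_mx i 0) = 1.
Proof. by rewrite /nrm /dot trmx_delta mul_delta_mx mxE !eqxx sqrtr1. Qed.

(** Each diagonal entry is a bilinear form in unit vectors. This is the only way in which operator
    bounds become trace bounds below. *)
Lemma trace_le A (k : R) : (forall x, nrm (A *m x) <= k * nrm x) ->
  `|\tr A| <= k * p%:R.
Proof.
move=> Ak; rewrite trace_dot (le_trans (ler_norm_sum _ _ _)) //.
rewrite -[p in p%:R](card_ord p) mulr_natr -sumr_const ler_sum // => i _.
rewrite (le_trans (dot_le_nrm _ _)) // nrm_delta mul1r.
by rewrite (le_trans (Ak _)) // nrm_delta mulr1.
Qed.

Lemma trace_mul_rank1 A u v : \tr (A *m (u *m v^T)) = dot v (A *m u).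
Proof. by rewrite mulmxA mxtrace_mulC /mxtrace big_ord1. Qed.

Section Coercive.
Variables (M : 'M[R]_p) (c : R).
Hypotheses (c_gt0 : 0 < c) (Mc : forall x, c * dot x x <= dot x (M *m x)).

(** A row r in the left kernel of [M^T] satisfies [M *m r^T = 0], and coercivity forces r = 0. *)
Lemma coercive_unitmx : M \in unitmx.
Proof.
rewrite -unitmx_tr -row_free_unit -kermx_eq0; apply/eqP/row_matrixP => i; rewrite row0.
set r := row i _.
have rM : r *m M^T = 0 by apply: sub_kermxP; rewrite row_sub.
have : M *m r^T = 0 by rewrite -[LHS]trmxK trmx_mul trmxK rM trmx0.
move=> Mr; have := Mc r^T; rewrite Mr dot0r pmulr_rle0 // => h.
have /eqP : dot r^T r^T == 0 by rewrite eq_le h dot_ge0.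
by move/eqP; rewrite dot_eq0 => /eqP /(congr1 trmx); rewrite trmxK trmx0.
Qed.

Lemma coercive_nrm_invmx x : nrm (invmx M *m x) <= c^-1 * nrm x.
Proof.
set w := invmx M *m x.
have Mw : M *m w = x by rewrite mulmxA mulmxV ?coercive_unitmx // mul1mx.
have := Mc w; rewrite Mw -sqr_nrm => h.
have [->|w0] := eqVneq (nrm w) 0; first by rewrite mulr_ge0 ?invr_ge0 ?(ltW c_gt0) ?nrm_ge0.
have w_gt0 : 0 < nrm w by rewrite lt_def w0 nrm_ge0.
rewrite mulrC ler_pdivlMr // -(ler_pM2l w_gt0) mulrA -expr2 mulrC.
by rewrite (le_trans h) // (le_trans (ler_norm _)) // dot_le_nrm.
Qed.

End Coercive.
End EuclideanVectors.

(** * Resolvents of Gram matrices *)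

Section Resolvent.
Context {R : realType} {p m : nat} (Y : 'M[R]_(p, m)).
Implicit Types (a b : R) (Q : 'M[R]_p).

Definition gram : 'M[R]_p := Y *m Y^T.

(** Written as a sum over the other columns, rather than as a difference with [gram], so that
    positivity and measurability with respect to those columns are immediate. *)
Definition gram_drop (j : 'I_m) : 'M[R]_p :=
  \sum_(k < m | k != j) col k Y *m (col k Y)^T.

Lemma gramE : gram = \sum_(k < m) col k Y *m (col k Y)^T.
Proof.
apply/matrixP => i l; rewrite summxE mxE; apply: eq_bigr => k _.
by rewrite !mxE big_ord1 !mxE.
Qed.

Lemma gram_dropE j : gram = col j Y *m (col j Y)^T + gram_drop j.
Proof. by rewrite gramE (bigD1 j). Qed.

Lemma dot_rank1 (x y : 'cV[R]_p) : dot x ((y *m y^T) *m x) = dot y x ^+ 2.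
Proof.
rewrite /dot mulmxA mulmxA -mulmxA mxE big_ord1 expr2; congr (_ * _).
by rewrite -/(dot x y) dotC.
Qed.

Lemma dot_sum_rank1_ge0 (S : pred 'I_m) x :
  0 <= dot x ((\sum_(k < m | S k) col k Y *m (col k Y)^T) *m x).
Proof.
rewrite mulmx_suml /dot mulmx_sumr summxE sumr_ge0 // => k _.
by rewrite -/(dot _ _) dot_rank1 sqr_ge0.
Qed.

Lemma tr_sum_rank1 (S : pred 'I_m) :
  (\sum_(k < m | S k) col k Y *m (col k Y)^T)^T =
  \sum_(k < m | S k) col k Y *m (col k Y)^T.
Proof. by rewrite linear_sum /=; apply: eq_bigr => k _; rewrite trmx_mul trmxK. Qed.

Definition psdmx (W : 'M[R]_p) := W^T = W /\ forall x, 0 <= dot x (W *m x).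

Lemma psd_gram : psdmx gram.
Proof. by rewrite gramE; split; [exact: tr_sum_rank1 | exact: dot_sum_rank1_ge0]. Qed.

Lemma psd_gram_drop j : psdmx (gram_drop j).
Proof. by split; [exact: tr_sum_rank1 | exact: dot_sum_rank1_ge0]. Qed.

Lemma psd_coercive W a : psdmx W ->
  forall x, a * dot x x <= dot x ((W + a%:M) *m x).
Proof.
by move=> [_ W0] x; rewrite mulmxDl dotDr mul_scalar_mx dotZr lerDr.
Qed.

Lemma Vmat_unit {W a} : psdmx W -> 0 < a -> W + a%:M \in unitmx.
Proof. by move=> W0 a0; apply: coercive_unitmx a0 (psd_coercive _ _ W0). Qed.

Lemma nrm_Vmat {W a} : psdmx W -> 0 < a ->
  forall x, nrm (Vmat W a *m x) <= a^-1 * nrm x.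
Proof. by move=> W0 a0; apply: coercive_nrm_invmx a0 (psd_coercive _ _ W0). Qed.

Lemma tr_Vmat W a : psdmx W -> (Vmat W a)^T = Vmat W a.
Proof.
by move=> [sW _]; rewrite /Vmat trmx_inv linearD /= sW tr_scalar_mx.
Qed.

Lemma Vmat_mulW W a : psdmx W -> 0 < a -> Vmat W a *m W = 1%:M - a *: Vmat W a.
Proof.
move=> W0 a0; rewrite -{2}(addrK a%:M W) mulmxBr mulVmx ?Vmat_unit //.
by rewrite mul_mx_scalar.
Qed.

(** Used twice: with equal shifts for the deletion of a column, and with equal matrices for the
    replacement of one shift by another. *)
Lemma Vmat_resolvent W W' a b : psdmx W -> psdmx W' -> 0 < a -> 0 < b ->
  Vmat W a - Vmat W' b = Vmat W a *m (W' + b%:M - (W + a%:M)) *m Vmat W' b.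
Proof.
move=> W0 W0' a0 b0; rewrite mulmxBr mulmxBl -(mulmxA _ _ (Vmat W' b)).
by rewrite mulmxV ?Vmat_unit // mulmx1 mulVmx ?Vmat_unit // mul1mx.
Qed.

Lemma trace_mul_gram Q : \tr (Q *m gram) = \sum_j dot (col j Y) (Q *m col j Y).
Proof.
by rewrite gramE mulmx_sumr linear_sum; apply: eq_bigr => j _; exact: trace_mul_rank1.
Qed.

Lemma trace_gram : \tr gram = \sum_j nrm (col j Y) ^+ 2.
Proof.
rewrite -[gram]mul1mx trace_mul_gram; apply: eq_bigr => j _.
by rewrite mul1mx sqr_nrm.
Qed.

Lemma trace_gram_ge0 : 0 <= \tr gram.
Proof. by rewrite trace_gram sumr_ge0 // => j _; rewrite sqr_ge0. Qed.

Section LeaveOneOut.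
Variables (a : R) (j : 'I_m).
Hypothesis a_gt0 : 0 < a.
Let y := col j Y.
Let V := Vmat gram a.
Let Vj := Vmat (gram_drop j) a.

Lemma Vmat_drop : Vj - V = Vj *m (y *m y^T) *m V.
Proof.
rewrite (Vmat_resolvent _ _ _ _ (psd_gram_drop j) psd_gram) //.
by congr (_ *m _ *m _); rewrite (gram_dropE j) opprD addrACA subrr addr0 addrK.
Qed.

(** The Sherman-Morrison formula in a form without division: [Vmat_drop] is applied to y, and
    [y^T V y] comes out as a scalar. *)
Lemma Vmat_col : V *m y = (1 - dot y (V *m y)) *: (Vj *m y).
Proof.
have /(congr1 (fun M => M *m y)) := Vmat_drop.
rewrite mulmxBl -[in RHS]mulmxA -[in RHS]mulmxA -[in RHS]mulmxA.
have -> : y *m (y^T *m (V *m y)) = dot y (V *m y) *: y.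
  by rewrite [y^T *m _]mx11_scalar mul_mx_scalar.
by rewrite -scalemxAr scalerBl scale1r => <-; rewrite opprB addrC subrK.
Qed.

(** With b = [y^T V y] and c = [y^T V_j y], [Vmat_col] gives b = (1 - b) c, hence (1 - b)(1 + c) =
    1, where b and c are nonnegative. *)
Lemma leave_one_out_weight : 0 < 1 - dot y (V *m y) <= 1.
Proof.
have Vy0 : 0 <= dot y (V *m y).
  (* Writing y as (W + a) w turns [y^T V y] into a quadratic form of W + a at w, to which coercivity
     applies. *)
  set w := V *m y; have -> : y = (gram + a%:M) *m w.
    by rewrite mulmxA mulmxV ?Vmat_unit ?mul1mx //; exact: psd_gram.
  rewrite dotC (le_trans _ (psd_coercive _ _ psd_gram _)) //.
  by rewrite mulr_ge0 ?dot_ge0 // ltW.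
have Vjy0 : 0 <= dot y (Vj *m y).
  set w := Vj *m y; have -> : y = (gram_drop j + a%:M) *m w.
    by rewrite mulmxA mulmxV ?Vmat_unit ?mul1mx //; exact: psd_gram_drop.
  rewrite dotC (le_trans _ (psd_coercive _ _ (psd_gram_drop j) _)) //.
  by rewrite mulr_ge0 ?dot_ge0 // ltW.
have := congr1 (dot y) Vmat_col; rewrite dotZr => h.
rewrite lerBlDr lerDl Vy0 andbT.
move: Vy0 Vjy0 h; set b := dot y (V *m y); set c := dot y (Vj *m y) => b0 c0 h.
have : (1 - b) * (1 + c) = 1 by lra.
by move=> h1; rewrite -(@pmulr_lgt0 _ (1 + c)) ?h1 //; lra.
Qed.

(** The difference is w e, with w the weight and e = |V_j y|^2. Coercivity gives a e <= c =
    [y^T V_j y], and w c = 1 - w <= 1 by [Vmat_col]. *)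
Lemma trace_drop : 0 <= \tr Vj - \tr V <= a^-1.
Proof.
rewrite -raddfB Vmat_drop /= mxtrace_mulC mulmxA trace_mul_rank1.
rewrite dot_mulmxr tr_Vmat; last exact: psd_gram.
have := leave_one_out_weight; have := congr1 (dot y) Vmat_col; have := Vmat_col.
set w := 1 - dot y (V *m y) => Vy.
rewrite dotZr (_ : dot y (V *m y) = 1 - w); last by rewrite /w opprB addrC subrK.
rewrite Vy dotZl.
have : a * dot (Vj *m y) (Vj *m y) <= dot y (Vj *m y).
  set x := Vj *m y; have -> : y = (gram_drop j + a%:M) *m x.
    by rewrite mulmxA mulmxV ?Vmat_unit ?mul1mx //; exact: psd_gram_drop.
  by rewrite (dotC _ x); apply: psd_coercive; exact: psd_gram_drop.
have := dot_ge0 (Vj *m y); set e := dot (Vj *m y) _; set c := dot y _.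
move=> e0 ae bE /andP[w0 w1]; apply/andP; split; first by rewrite mulr_ge0 // ltW.
rewrite -(ler_pM2l a_gt0) divff ?gt_eqF // mulrCA.
rewrite (@le_trans _ _ (w * c)) ?ler_pM2l //.
by rewrite -bE; lra.
Qed.

End LeaveOneOut.

(** * Deterministic estimates for the numerator and for the traces in it *)

Section Discrepancy.
Variables (B : 'M[R]_p) (k : R).
Hypotheses (k_ge0 : 0 <= k) (nrm_B : forall x, nrm (B *m x) <= k * nrm x).

(* The numerator of [a_S + (2 c0 + 1) - a_star] for [B = invmx Psi] and
   [m = n - 1]. *)
Definition discrepancy a : R :=
  \tr (Vmat gram a) * (m%:R - p%:R + a * \tr (Vmat gram a)) -
  (\tr B - a * \tr (Vmat gram a *m B)).

Definition fluctuation a j : R :=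
  dot (col j Y) (B *m Vmat (gram_drop j) a *m col j Y) -
  \tr (Vmat (gram_drop j) a).

Lemma trace_Vmat_gram a : 0 < a ->
  \tr (Vmat gram a *m gram) = p%:R - a * \tr (Vmat gram a).
Proof.
move=> a0; rewrite Vmat_mulW //; last exact: psd_gram.
by rewrite raddfB /= mxtraceZ mxtrace1.
Qed.

Lemma trace_Vmat_gram_B a : 0 < a ->
  \tr B - a * \tr (Vmat gram a *m B) =
  \sum_j dot (col j Y) (B *m Vmat gram a *m col j Y).
Proof.
move=> a0; rewrite -trace_mul_gram -mulmxA Vmat_mulW //; last exact: psd_gram.
rewrite mulmxBr mulmx1 -scalemxAr raddfB /= mxtraceZ.
by rewrite (mxtrace_mulC B).
Qed.

(** The weights are at most 1, and passing from [tr V] to [tr V_j] costs at most 1/a in each of the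
    m summands. *)
Lemma discrepancy_le a : 0 < a ->
  `|discrepancy a| <= m%:R / a + \sum_j `|fluctuation a j|.
Proof.
move=> a0; rewrite /discrepancy trace_Vmat_gram_B //.
have -> : m%:R - p%:R + a * \tr (Vmat gram a) =
    \sum_j (1 - dot (col j Y) (Vmat gram a *m col j Y)).
  rewrite sumrB -trace_mul_gram trace_Vmat_gram // sumr_const card_ord.
  by rewrite opprB; ring.
rewrite mulr_sumr -sumrB (le_trans (ler_norm_sum _ _ _)) //.
have -> : m%:R / a = \sum_(j < m) a^-1 by rewrite sumr_const card_ord mulr_natl.
rewrite -big_split ler_sum //= => j _.
have /andP[t0 t1] := trace_drop a j a0.
have := Vmat_col a j a0; have := leave_one_out_weight a j a0; rewrite /fluctuation.
set w := 1 - _ => /andP[w0 w1] Vy.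
rewrite -mulmxA Vy -scalemxAr dotZr mulmxA.
rewrite mulrC -mulrBr normrM ger0_norm ?(ltW w0) //.
apply: (@le_trans _ _ (1 * (a^-1 + `|dot (col j Y) (B *m Vmat (gram_drop j) a *m col j Y) -
   \tr (Vmat (gram_drop j) a)|))); last by rewrite mul1r.
apply: ler_pM => //; first exact: ltW.
rewrite distrC -[X in `|X|](subrKA (\tr (Vmat (gram_drop j) a))).
rewrite (le_trans (ler_normD _ _)) // addrC lerD //.
by rewrite ger0_norm.
Qed.

Lemma trace_Vmat_le a : 0 < a -> `|\tr (Vmat gram a)| <= p%:R / a.
Proof. by move=> a0; rewrite mulrC; apply/trace_le/nrm_Vmat => //; exact: psd_gram. Qed.

Lemma Vmat_perturb a b : 0 < a -> 0 < b ->
  Vmat gram a - Vmat gram b = (b - a) *: (Vmat gram a *m Vmat gram b).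
Proof.
move=> a0 b0; rewrite (Vmat_resolvent _ _ _ _ psd_gram psd_gram) //.
have -> : gram + b%:M - (gram + a%:M) = (b - a)%:M by rewrite opprD addrACA subrr add0r raddfB.
by rewrite mul_mx_scalar -scalemxAl.
Qed.

Lemma trace_Vmat_perturb a b : 0 < a -> 0 < b ->
  `|\tr (Vmat gram a) - \tr (Vmat gram b)| <= `|a - b| * p%:R / (a * b).
Proof.
move=> a0 b0; rewrite -raddfB Vmat_perturb //= mxtraceZ normrM distrC -mulrA.
rewrite ler_wpM2l // mulrC; apply: trace_le => x.
rewrite -mulmxA (le_trans (nrm_Vmat psd_gram a0 _)) //.
rewrite invfM -mulrA ler_wpM2l ?invr_ge0 ?(ltW a0) //.
exact: nrm_Vmat psd_gram b0 _.
Qed.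

(** The sum over columns of [y^T B V y] is compared term by term, which produces the factor
    [\tr gram]. This trace is O(n^2), as is a b when both shifts are of order n, so that a multiple
    of |a - b| remains. *)
Lemma trace_Vmat_B_perturb a b : 0 < a -> 0 < b ->
  `|(\tr B - a * \tr (Vmat gram a *m B)) - (\tr B - b * \tr (Vmat gram b *m B))|
  <= `|a - b| * k * \tr gram / (a * b).
Proof.
move=> a0 b0; rewrite !trace_Vmat_gram_B // -sumrB (le_trans (ler_norm_sum _ _ _)) //.
have -> : `|a - b| * k * \tr gram / (a * b) =
   \sum_(j < m) (`|a - b| * (k * (a^-1 * (b^-1 * nrm (col j Y))) * nrm (col j Y))).
  rewrite trace_gram mulr_sumr mulr_suml; apply: eq_bigr => j _.
  by rewrite invfM; ring.
apply: ler_sum => j _.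
rewrite -dotBr -mulmxBl -mulmxBr Vmat_perturb // -scalemxAr -scalemxAl dotZr normrM.
rewrite distrC ler_wpM2l // (le_trans (dot_le_nrm _ _)) // mulrC.
rewrite ler_wpM2r ?nrm_ge0 // -!mulmxA (le_trans (nrm_B _)) // ler_wpM2l //.
rewrite (le_trans (nrm_Vmat psd_gram a0 _)) // ler_wpM2l ?invr_ge0 ?(ltW a0) //.
exact: nrm_Vmat psd_gram b0 _.
Qed.

(** The sum over j of |V y_j - s y_j|^2 is nonnegative: Cauchy-Schwarz with a weight s left free, to
    be tuned in [trace_sqr_lower_bound]. *)
Lemma sqr_trace_ineq a s :
  2 * s * \tr (Vmat gram a *m gram) <=
  \tr (Vmat gram a *m Vmat gram a *m gram) + s ^+ 2 * \tr gram.
Proof.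
rewrite -subr_ge0.
have -> : \tr (Vmat gram a *m Vmat gram a *m gram) + s ^+ 2 * \tr gram -
    2 * s * \tr (Vmat gram a *m gram) =
  \sum_j dot (Vmat gram a *m col j Y - s *: col j Y) (Vmat gram a *m col j Y - s *: col j Y).
  rewrite trace_gram !trace_mul_gram !mulr_sumr -big_split -sumrB /=.
  apply: eq_bigr => j _; rewrite sqr_nrm !(dotBl, dotBr, dotZl, dotZr).
  rewrite -mulmxA (dot_mulmxr (col j Y) (Vmat gram a) (Vmat gram a *m _)) tr_Vmat.
    by rewrite (dotC (Vmat gram a *m _) (col j Y)); ring.
  exact: psd_gram.
by apply: sumr_ge0 => j _; exact: dot_ge0.
Qed.

Lemma trace_sqr_gram_ge0 a : 0 <= \tr (Vmat gram a *m Vmat gram a *m gram).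
Proof. by have := sqr_trace_ineq a 0; rewrite !(mulr0, mul0r, expr0n, addr0). Qed.

(** Each [y^T B V y] is at most k |y| |V y|; then 2 |y| |V y| <= s |y|^2 + |V y|^2 / s, with the
    same kind of free weight. *)
Lemma trace_B_ineq a s : 0 < a -> 0 < s ->
  2 * (\tr B - a * \tr (Vmat gram a *m B)) <=
  k * (s * \tr gram + \tr (Vmat gram a *m Vmat gram a *m gram) / s).
Proof.
move=> a0 s0; rewrite trace_Vmat_gram_B // trace_gram trace_mul_gram.
rewrite !mulr_sumr mulr_suml -big_split mulr_sumr ler_sum //= => j _.
rewrite -mulmxA (@le_trans _ _ (2 * (nrm (col j Y) * (k * nrm (Vmat gram a *m col j Y))))) //.
  rewrite ler_wpM2l // (le_trans (ler_norm _)) // (le_trans (dot_le_nrm _ _)) //.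
  by rewrite ler_wpM2l ?nrm_ge0.
rewrite -mulmxA dot_mulmxr tr_Vmat; last exact: psd_gram.
rewrite -sqr_nrm; move: (nrm _) (nrm _) => u v.
have -> : 2 * (v * (k * u)) = k * (2 * (v * u)) by ring.
rewrite ler_wpM2l //.
rewrite -subr_ge0.
have -> : s * v ^+ 2 + u ^+ 2 / s - 2 * (v * u) = (s * v - u) ^+ 2 / s.
  by field; rewrite gt_eqF.
by rewrite divr_ge0 ?sqr_ge0 // ltW.
Qed.

(* [z V z] is positive for [z = 1 - s (W + a)]. *)
Lemma trace_Vmat_ge a s : 0 < a ->
  2 * s * p%:R - s ^+ 2 * (\tr gram + a * p%:R) <= \tr (Vmat gram a).
Proof.
move=> a0; rewrite -subr_ge0.
set V := Vmat gram a; set Q := gram + a%:M; set z := 1%:M - s *: Q.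
have QV : Q *m V = 1%:M by rewrite mulmxV ?Vmat_unit //; exact: psd_gram.
have VQ : V *m Q = 1%:M by rewrite mulVmx ?Vmat_unit //; exact: psd_gram.
have -> : \tr V - (2 * s * p%:R - s ^+ 2 * (\tr gram + a * p%:R)) = \tr (z *m V *m z).
  have -> : z *m V = V - s%:M by rewrite /z mulmxBl mul1mx -scalemxAl QV scalemx1.
  rewrite /z mulmxBr mulmx1 -scalemxAr mulmxBl VQ mul_scalar_mx.
  have trB (C D : 'M[R]_p) : \tr (C - D) = \tr C - \tr D by exact: raddfB.
  rewrite !trB mxtrace_scalar !mxtraceZ trB mxtrace1 mxtraceZ mxtraceD mxtrace_scalar.
  rewrite -(mulr_natr s) -(mulr_natr a).
  by ring.
have zT : z^T = z.
  by rewrite /z linearB /= trmx1 linearZ /= linearD /= tr_scalar_mx (psd_gram.1).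
rewrite trace_dot sumr_ge0 // => i _; pose e : 'cV[R]_p := z *m delta_mx i 0.
have -> : z *m V *m z *m delta_mx i 0 = z *m (V *m e) by rewrite !mulmxA.
rewrite dot_mulmxr zT -/e; clearbody e; have -> : e = Q *m (V *m e) by rewrite mulmxA QV mul1mx.
rewrite (mulmxA V) VQ mul1mx dotC (le_trans _ (psd_coercive _ _ psd_gram _)) //.
by rewrite mulr_ge0 ?dot_ge0 // ltW.
Qed.

End Discrepancy.
End Resolvent.

(** * Quadratic forms and eigenvalues *)

Section SpectralBounds.
Context {R : realType} {p : nat}.
Local Open Scope complex_scope.
Local Open Scope sesquilinear_scope.

(** The matrix is diagonalized over the complex numbers as a normal matrix. In the unitary
    coordinates z of x both forms become weighted sums of the |z_k|^2. *)
Lemma quadratic_form_bounds (A : 'M[R]_p) (tau : 'I_p -> R) (c1 c2 : R) :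
  A^T = A -> char_poly A = \prod_(j < p) ('X - (tau j)%:P) ->
  (forall j, c1 <= tau j <= c2) ->
  forall x, c1 * dot x x <= dot x (A *m x) <= c2 * dot x x.
Proof.
move=> symA chA tauc x.
pose f := real_complex R; pose AC := map_mx f A; pose xC := map_mx f x.
have fconj m n (M : 'M[R]_(m, n)) : (map_mx f M)^t* = map_mx f M^T.
  by apply/matrixP => i j; rewrite !mxE; exact: conjc_real.
have normalA : AC \is normalmx by apply/normalmxP; rewrite fconj symA.
have /orthomx_spectralP := normalA.
set U := spectralmx AC; set s := spectral_diag AC => AE.
have Uu : U \is unitarymx by exact: spectral_unitarymx.
(* A diagonal entry has the k-th row of U as eigenvector, so it is a root of the characteristic
   polynomial and hence one of the [tau j]. *)
have sE k : exists j, s 0 k = f (tau j).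
  have : eigenvalue AC (s 0 k).
    apply/eigenvalueP; exists (row k U).
      rewrite AE !mulmxA -row_mul mulmxV ?unitarymx_unit // row1.
      rewrite -rowE; apply/rowP => i.
      rewrite !mxE (bigD1 k) //= !mxE eqxx mulr1n big1 ?addr0 ?mxE //.
      by move=> l lk; rewrite !mxE eq_sym (negbTE lk) mul0r.
    apply/eqP => U0; have /(congr1 (fun M : 'rV_p => M 0 k)) : row k (U *m invmx U) = 0.
      by rewrite row_mul U0 mul0mx.
    by rewrite mulmxV ?unitarymx_unit // !mxE eqxx => /eqP; rewrite oner_eq0.
  rewrite eigenvalue_root_char -map_char_poly chA rmorph_prod /= /root horner_prod => /eqP/eqP.
  case/prodf_eq0 => j _; rewrite rmorphB /= map_polyX map_polyC hornerXsubC subr_eq0.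
  by move=> /eqP ->; exists j.
pose z := U *m xC.
have quad M : (xC^t* *m map_mx f M *m xC) 0 0 = f (dot x (M *m x)).
  by rewrite fconj -!map_mxM /= mxE /dot mulmxA.
have xAx : f (dot x (A *m x)) = \sum_k s 0 k * `|z k 0| ^+ 2.
  rewrite -quad -/AC AE invmx_unitary // !mulmxA.
  have -> : xC^t* *m U^t* = z^t* by rewrite /z trmx_mul map_mxM.
  rewrite -mulmxA mxE; apply: eq_bigr => k _.
  by rewrite mul_mx_diag !mxE normCKC mulrAC mulrA mulrC mulrA.
have xx : f (dot x x) = \sum_k `|z k 0| ^+ 2.
  rewrite -[x in dot _ x]mul1mx -quad map_mx1 mulmx1.
  have -> : xC^t* *m xC = z^t* *m z.
    by rewrite /z trmx_mul map_mxM mulmxA mulmxKtV.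
  by rewrite mxE; apply: eq_bigr => k _; rewrite !mxE normCKC.
rewrite -!lecR !rmorphM /= -/f xAx xx !mulr_sumr.
apply/andP; split; apply: ler_sum => k _; have [j ->] := sE k;
  have /andP[h1 h2] := tauc j; by rewrite ler_wpM2r ?exprn_ge0 // lecR.
Qed.

End SpectralBounds.

(** * Moments of the normal law *)

Section NormalMoments.
Context {R : realType}.
Local Notation mu := (@lebesgue_measure R).

(** The bound t <= exp t at t = c x^2 / m, raised to the power m, controls u^2 for u = |x|^m; then 2
    u <= 1 + u^2 controls u. *)
Lemma pow_le_expR (m : nat) (c x : R) : 0 < c ->
  `|x| ^+ m <= (1 + (m%:R / c) ^+ m) * expR (c * x ^+ 2).
Proof.
move=> c0; have cx0 : 0 <= c * x ^+ 2 by rewrite mulr_ge0 ?sqr_ge0 // ltW.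
have e1 : 1 <= expR (c * x ^+ 2) by rewrite -expR0 ler_expR.
have : (x ^+ 2) ^+ m <= (m%:R / c) ^+ m * expR (c * x ^+ 2).
  case: m => [|m]; first by rewrite !expr0 mul1r.
  have -> : c * x ^+ 2 = m.+1%:R * (x ^+ 2 * (c / m.+1%:R)) by field.
  rewrite expRM_natl -exprMn lerXn2r ?nnegrE ?sqr_ge0 //.
    by rewrite mulr_ge0 ?expR_ge0 // divr_ge0 // ltW.
  rewrite -ler_pdivrMl ?divr_gt0 // invf_div mulrC.
  by rewrite (le_trans _ (expR_ge1Dx _)) // lerDr.
rewrite -{1}(real_normK (num_real x)) -exprM mulnC exprM => h.
rewrite mulrDl mul1r; have u0 : 0 <= `|x| ^+ m by rewrite exprn_ge0.
have := sqr_ge0 (`|x| ^+ m - 1); rewrite sqrrB1; move: h e1 u0.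
have := sqr_ge0 (`|x| ^+ m); set u := `|x| ^+ m; set v := _ * expR _; lra.
Qed.

Section Density.
Variable s : R.
Hypothesis s_gt0 : 0 < s.
Local Notation g := (normal_pdf 0 s).
Let sN0 : s != 0. Proof. by rewrite gt_eqF. Qed.

(** Domination by a Gaussian density of twice the deviation yields both integrability of all powers
    and decay of the boundary terms. *)
Lemma normal_pdf_moment_bound m : exists2 C : R, 0 <= C &
  forall x, `|x| ^+ m * g x <= C * normal_pdf 0 (2 * s) x.
Proof.
(* The gap between the decay rates 1 / (2 s^2) and 1 / (8 s^2) of the two densities. *)
set c := 3 / (8 * s ^+ 2).
have c0 : 0 < c by rewrite divr_gt0 // mulr_gt0 // exprn_gt0.
have s20 : 2 * s != 0 by rewrite mulf_neq0.
exists ((1 + (m%:R / c) ^+ m) * (normal_peak s / normal_peak (2 * s))).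
  by rewrite mulr_ge0 ?divr_ge0 ?normal_peak_ge0 // addr_ge0 // exprn_ge0 // divr_ge0 // ltW.
move=> x; rewrite !normal_pdfE // /normal_fun !subr0.
have -> : - x ^+ 2 / (s ^+ 2 *+ 2) = - (c * x ^+ 2) + - x ^+ 2 / ((2 * s) ^+ 2 *+ 2).
  by rewrite -(mulr_natr (s ^+ 2)) -(mulr_natr ((2 * s) ^+ 2)) /c; field.
rewrite expRD expRN.
set e := expR (c * x ^+ 2); set e' := expR (- x ^+ 2 / _).
have e0 : 0 < e by exact: expR_gt0.
have e'0 : 0 < e' by exact: expR_gt0.
have k0 : normal_peak (2 * s) != 0 by rewrite gt_eqF // normal_peak_gt0.
have -> : (1 + (m%:R / c) ^+ m) * (normal_peak s / normal_peak (2 * s)) *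
  (normal_peak (2 * s) * e') = ((1 + (m%:R / c) ^+ m) * e) * (normal_peak s * (e^-1 * e')).
  by field; rewrite gt_eqF // k0.
rewrite ler_wpM2r ?pow_le_expR //.
by rewrite mulr_ge0 ?normal_peak_ge0 // mulr_ge0 ?invr_ge0 ?ltW.
Qed.

Lemma continuous_Xn_normal_pdf m : continuous (fun x : R => x ^+ m * g x).
Proof.
move=> x; apply: cvgM; first exact: exprn_continuous.
exact: continuous_normal_pdf.
Qed.

Lemma integrable_Xn_normal_pdf m :
  mu.-integrable setT (fun x => (x ^+ m * g x)%:E).
Proof.
have [C C0 Cle] := normal_pdf_moment_bound m.
apply: (@le_integrable _ _ _ mu setT _ _ (fun x => (C * normal_pdf 0 (2 * s) x)%:E)) => //.
- apply/measurable_EFinP; apply: continuous_measurable_fun.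
  exact: continuous_Xn_normal_pdf.
- move=> x _; rewrite lee_fin normrM normrX.
  rewrite (ger0_norm (normal_pdf_ge0 _ _ _)) (le_trans (Cle x)) //; exact: ler_norm.
- under eq_fun do rewrite EFinM.
  by apply: integrableZl => //; exact: integrable_normal_pdf.
Qed.

Lemma is_derive_Xn_normal_pdf m (x : R) :
  is_derive x 1 (fun x => x ^+ m * g x)
    (m%:R * (x ^+ m.-1 * g x) - s ^- 2 * (x ^+ m.+1 * g x)).
Proof.
have dX k : is_derive x 1 (fun y : R => y ^+ k) (k%:R * x ^+ k.-1).
  have -> : (fun y : R => y ^+ k) = (@idfun R) ^+ k by apply/funext => y; rewrite exprfctE.
  by apply: is_derive_eq; rewrite /GRing.scale /= mulr1.
rewrite normal_pdfE // /normal_fun.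
pose c := - (s ^+ 2 *+ 2)^-1; pose e (y : R) := expR (c * y ^+ 2).
have de : is_derive x 1 e (e x * (c * (2 * x))).
  have dq : is_derive x 1 (c *: (fun y : R => y ^+ 2)) (c * (2 * x)).
    by have dX2 := dX 2%N; apply: is_derive_eq; rewrite /GRing.scale /= expr1.
  exact: (is_derive1_comp (is_derive_expR _) dq).
have -> : (fun x => x ^+ m * (normal_peak s * expR (- (x - 0) ^+ 2 / (s ^+ 2 *+ 2)))) =
    normal_peak s *: ((fun y : R => y ^+ m) * e).
  apply/funext => y; rewrite subr0 /e /c /= -[RHS]/(_ * (_ * _)) mulrCA; congr (_ * (_ * expR _)).
  by rewrite !mulNr mulrC.
have -> : expR (- (x - 0) ^+ 2 / (s ^+ 2 *+ 2)) = e x.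
  by rewrite subr0 /e /c !mulNr (mulrC (x ^+ 2)).
apply: is_derive_eq; rewrite /GRing.scale /= /c.
rewrite (exprS x m) -(mulr_natr (s ^+ 2)).
by field.
Qed.

(** These are the boundary terms of the integration by parts on [-N, N]. The bound for the power m +
    1 gains the factor 1/N. *)
Lemma normal_pdf_moment_cvg m :
  (fun N : nat => (N%:R ^+ m * g N%:R) - ((- N%:R) ^+ m * g (- N%:R))) @ \oo --> 0.
Proof.
have [C C0 Cle] := normal_pdf_moment_bound m.+1.
pose K := 2 * (C * normal_peak (2 * s)).
have s20 : 2 * s != 0 by rewrite mulf_neq0.
have bnd (x : R) : 0 < `|x| -> `|x ^+ m * g x| <= `|x|^-1 * (C * normal_peak (2 * s)).
  move=> x0; rewrite -(ler_pM2l x0) mulrA mulrA divff ?gt_eqF // mul1r.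
  rewrite normrM normrX (ger0_norm (normal_pdf_ge0 _ _ _)) mulrA -exprS.
  by rewrite (le_trans (Cle x)) // ler_wpM2l // normal_pdf_ub.
rewrite -cvg_shiftS /=.
apply: (@squeeze_cvgr _ _ _ _ (fun N : nat => - (N.+1%:R^-1 * K)) (fun N : nat => N.+1%:R^-1 * K)).
- near=> N; rewrite -ler_norml (le_trans (ler_normB _ _)) //.
  rewrite /K mulrCA mulr2n mulrDl !mul1r lerD //.
    by rewrite (le_trans (bnd _ _)) // ?normr_nat // normr_gt0.
  by rewrite (le_trans (bnd _ _)) // ?normrN ?normr_nat // normr_gt0.
- rewrite -oppr0; apply: cvgN; rewrite -[X in _ --> X](mul0r K).
  by apply: cvgMl; exact: cvg_harmonic.
- by rewrite -[X in _ --> X](mul0r K); apply: cvgMl; exact: cvg_harmonic.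
Unshelve. all: by end_near. Qed.

(** The derivative of x^m g integrates over [-N, N] to boundary terms that vanish in the limit, and
    dominated convergence passes to the line. At m = 0 the truncated exponent [m.-1] is harmless, as
    its coefficient is 0. *)
Lemma integral_Xn_normal_pdf m :
  (\int[mu]_x (x ^+ m.+1 * g x))%R =
  m%:R * s ^+ 2 * (\int[mu]_x (x ^+ m.-1 * g x))%R.
Proof.
pose h (x : R) := m%:R * (x ^+ m.-1 * g x) - s ^- 2 * (x ^+ m.+1 * g x).
have ch : continuous h.
  move=> x; apply: cvgB; apply: cvgM; try exact: cvg_cst; exact: continuous_Xn_normal_pdf.
have mh : measurable_fun setT h by exact: continuous_measurable_fun.
have ih1 : mu.-integrable setT (fun x => (m%:R * (x ^+ m.-1 * g x))%:E).
  by under eq_fun do rewrite EFinM; apply: integrableZl => //; exact: integrable_Xn_normal_pdf.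
have ih2 : mu.-integrable setT (fun x => (s ^- 2 * (x ^+ m.+1 * g x))%:E).
  by under eq_fun do rewrite EFinM; apply: integrableZl => //; exact: integrable_Xn_normal_pdf.
have ih : mu.-integrable setT (EFin \o h).
  by rewrite /h; apply: (integrableB measurableT ih1 ih2).
have hE : (\int[mu]_x h x)%R = m%:R * (\int[mu]_x (x ^+ m.-1 * g x))%R -
    s ^- 2 * (\int[mu]_x (x ^+ m.+1 * g x))%R.
  rewrite /h RintegralB // RintegralZl //; last exact: integrable_Xn_normal_pdf.
  by rewrite RintegralZl //; exact: integrable_Xn_normal_pdf.
pose I (N : nat) := `[- N%:R, N%:R]%classic : set R.
have FTC N : (0 < N)%N ->
    (\int[mu]_(x in I N) (h x)%:E = (N%:R ^+ m * g N%:R - (- N%:R) ^+ m * g (- N%:R))%:E)%E.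
  move=> N0; rewrite EFinB; apply: (@continuous_FTC2 _ h (fun x => x ^+ m * g x)).
  - by rewrite (@lt_trans _ _ 0) ?oppr_lt0 ?ltr0n.
  - exact: continuous_subspaceT.
  - split.
    + by move=> x _; have [] := is_derive_Xn_normal_pdf m x.
    + by apply: cvg_at_right_filter; exact: continuous_Xn_normal_pdf.
    + by apply: cvg_at_left_filter; exact: continuous_Xn_normal_pdf.
  - by move=> x _; rewrite derive1E; have [_ ->] := is_derive_Xn_normal_pdf m x.
have cv : (fun N => \int[mu]_(x in I N) (h x)%:E)%E @ \oo --> (\int[mu]_x (h x)%:E)%E.
  under eq_fun do rewrite integral_mkcond.
  have [] := @dominated_convergence _ _ _ mu setT measurableT
    (fun N => (fun x => (h x)%:E) \_ (I N))%E (EFin \o h) (fun x => `|(h x)%:E|)%E.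
  - move=> N; apply/(measurable_restrictT _ _).1; first exact: measurable_itv.
    by apply/measurable_EFinP; exact: measurable_funTS.
  - exact/measurable_EFinP.
  - apply/aeW => x _; apply: cvg_near_cst; near=> N.
    rewrite patchE mem_set // /I /= in_itv /= -ler_norml.
    by near: N; exact: nbhs_infty_ger.
  - exact: integrable_abse.
  - apply/aeW => x N _; rewrite patchE; case: ifPn => // _.
    by rewrite abse0.
  - by [].
have h0 : (\int[mu]_x (h x)%:E = 0)%E.
  apply: (cvg_unique _ cv) => //.
  have : (EFin \o (fun N : nat => (N%:R ^+ m * g N%:R) - ((- N%:R) ^+ m * g (- N%:R)))) @ \oo --> 0%E.
    by apply: cvg_EFin; [exact: nearW | exact: normal_pdf_moment_cvg].
  apply: cvg_trans; apply: near_eq_cvg; near=> N; rewrite /= FTC //.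
  by near: N; exact: nbhs_infty_gt.
move: hE; rewrite /Rintegral h0 /= => /eqP; rewrite eq_sym subr_eq0 => /eqP hE.
rewrite mulrAC (mulrC _ (s ^+ 2)) hE mulrA divff ?mul1r //.
by rewrite expf_neq0.
Unshelve. all: by end_near. Qed.

End Density.
End NormalMoments.

(** * Expectations under a normal law, and variables with all moments *)

Section NormalLaw.
Context {R : realType} {d} {T : measurableType d} (P : probability T R).
Local Notation mu := (@lebesgue_measure R).

(** The Radon-Nikodym derivative of [normal_prob] and [normal_pdf] have the same integral over every
    measurable set, so they agree almost everywhere. This settles nonnegative f; the general case
    splits f into positive and negative parts. *)
Lemma integral_normal_prob (s : R) (f : R -> \bar R) : s != 0 ->
  measurable_fun setT f ->
  (\int[normal_prob 0 s]_x f x = \int[mu]_x (f x * (normal_pdf 0 s x)%:E))%E.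
Proof.
move=> s0 mf.
have dom := @normal_prob_dominates R 0 s.
have mpdf : measurable_fun setT (fun x => (normal_pdf 0 s x)%:E).
  by apply/measurable_EFinP; exact: measurable_normal_pdf.
have ge0 (h : R -> \bar R) : measurable_fun setT h -> (forall x, 0 <= h x)%E ->
    (\int[normal_prob 0 s]_x h x = \int[mu]_x (h x * (normal_pdf 0 s x)%:E))%E.
  move=> mh h0.
  rewrite -(Radon_Nikodym_SigmaFinite.change_of_variables dom h0 measurableT mh).
  have idens := Radon_Nikodym_SigmaFinite.f_integrable dom.
  apply: ae_eq_integral => //.
  - by apply: emeasurable_funM => //; exact: measurable_int idens.
  - exact: emeasurable_funM.
  - apply: ae_eqe_mul2l; apply: integral_ae_eq => // E _ mE.
    by rewrite -Radon_Nikodym_SigmaFinite.f_integral.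
rewrite integralE [RHS]integralE; congr (_ - _)%E.
- rewrite ge0 //; last exact: measurable_funepos.
  apply: eq_integral => x _; rewrite !funeposE maxeMl ?lee_fin ?normal_pdf_ge0 //.
  by rewrite mul0e.
- rewrite ge0 //; last exact: measurable_funeneg.
  apply: eq_integral => x _; rewrite !funenegE maxeMl ?lee_fin ?normal_pdf_ge0 //.
  by rewrite mul0e mulNe.
Qed.

Lemma integral_normal_law (Z : T -> R) (v : R) (f : R -> \bar R) :
  has_normal_law P Z 0 v -> 0 < v -> measurable_fun setT f ->
  (\int[P]_w f (Z w) = \int[mu]_x (f x * (normal_pdf 0 (Num.sqrt v) x)%:E))%E.
Proof.
move=> [mZ lawZ] v0 mf; rewrite -integral_normal_prob ?gt_eqF ?sqrtr_gt0 //.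
have ge0 (h : R -> \bar R) : measurable_fun setT h -> (forall x, 0 <= h x)%E ->
    (\int[P]_w h (Z w) = \int[normal_prob 0 (Num.sqrt v)]_x h x)%E.
  move=> mh h0; rewrite -[LHS](@ge0_integral_pushforward _ _ T (measurableTypeR R) R Z mZ P setT h) //.
  apply: (@eq_measure_integral _ (measurableTypeR R) R setT (normal_prob 0 (Num.sqrt v))).
  by move=> A mA _; exact: lawZ.
rewrite integralE [RHS]integralE; congr (_ - _)%E.
- rewrite -ge0 //; last exact: measurable_funepos.
  by apply: eq_integral => w _; rewrite !funeposE.
- rewrite -ge0 //; last exact: measurable_funeneg.
  by apply: eq_integral => w _; rewrite !funenegE.
Qed.

(** Unlike integrability, this class is closed under sums, products and powers, so it settles the
    side conditions for every polynomial in Gaussian variables. *)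
Definition all_moments (Z : T -> R) :=
  forall m, P.-integrable setT (fun w => (Z w ^+ m)%:E).

Lemma normal_law_all_moments (Z : T -> R) (v : R) :
  has_normal_law P Z 0 v -> 0 < v -> all_moments Z.
Proof.
move=> lawZ v0 m; have [mZ _] := lawZ.
have s0 : 0 < Num.sqrt v by rewrite sqrtr_gt0.
have mX : measurable_fun setT (fun x : R => `|x ^+ m|%:E).
  by apply/measurable_EFinP/measurableT_comp => //; exact: measurable_funX.
apply/integrableP; split.
  by apply/measurable_EFinP; exact: measurable_funX.
rewrite (integral_normal_law Z v (fun x => `|x ^+ m|%:E)%E lawZ v0 mX).
have /integrableP[_] := integrable_Xn_normal_pdf _ s0 m.
congr (_ < _)%E; apply: eq_integral => x _ /=.
by rewrite -EFinM normrM (ger0_norm (normal_pdf_ge0 _ _ _)).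
Qed.

Lemma normal_law_moment (Z : T -> R) (v : R) m :
  has_normal_law P Z 0 v -> 0 < v ->
  \int[P]_w (Z w ^+ m.+1) = m%:R * v * \int[P]_w (Z w ^+ m.-1).
Proof.
move=> lawZ v0.
have E k : \int[P]_w (Z w ^+ k) = \int[mu]_x (x ^+ k * normal_pdf 0 (Num.sqrt v) x).
  have mX : measurable_fun setT (fun x : R => (x ^+ k)%:E).
    by apply/measurable_EFinP; exact: measurable_funX.
  by rewrite /Rintegral (integral_normal_law Z v (fun x => (x ^+ k)%:E) lawZ v0 mX).
by rewrite !E integral_Xn_normal_pdf ?sqrtr_gt0 // sqr_sqrtr // ltW.
Qed.

Lemma all_moments_integrable Z : all_moments Z -> P.-integrable setT (EFin \o Z).
Proof. by move=> /(_ 1%N); congr (P.-integrable _ _); apply/funext => w; rewrite expr1. Qed.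

Lemma all_moments_measurable Z : all_moments Z -> measurable_fun setT Z.
Proof. by move=> /all_moments_integrable /measurable_int /measurable_EFinP. Qed.

Lemma all_moments_cst c : all_moments (cst c).
Proof.
move=> m; have := finite_measure_integrable_cst P (c ^+ m).
by move=> /(_ setT measurableT).
Qed.

Lemma integrable_mul_moments Y Z i j : all_moments Y -> all_moments Z ->
  P.-integrable setT (fun w => (Y w ^+ i * Z w ^+ j)%:E).
Proof.
move=> mY mZ.
apply: (@le_integrable _ _ _ P setT _ _ (fun w => (Y w ^+ (i * 2) + Z w ^+ (j * 2))%:E)) => //.
- by apply/measurable_EFinP/measurable_funM; apply: measurable_funX; exact: all_moments_measurable.
- move=> w _; rewrite lee_fin !exprM [leRHS]ger0_norm ?addr_ge0 ?sqr_ge0 // normrM.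
  rewrite -(real_normK (num_real (Y w ^+ i))) -(real_normK (num_real (Z w ^+ j))).
  move: `|_| `|_| (normr_ge0 (Y w ^+ i)) (normr_ge0 (Z w ^+ j)) => a b a0 b0.
  by have := sqr_ge0 (a - b); rewrite sqrrB; have := mulr_ge0 a0 b0; lra.
- by have := integrableD measurableT (mY (i * 2)%N) (mZ (j * 2)%N).
Qed.

Lemma all_momentsM Y Z : all_moments Y -> all_moments Z ->
  all_moments (fun w => Y w * Z w).
Proof.
move=> mY mZ m; have := integrable_mul_moments Y Z m m mY mZ.
by congr (P.-integrable _ _); apply/funext => w; rewrite exprMn.
Qed.

Lemma all_momentsD Y Z : all_moments Y -> all_moments Z ->
  all_moments (fun w => Y w + Z w).
Proof.
move=> mY mZ m.
have -> : (fun w => ((Y w + Z w) ^+ m)%:E) =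
  (fun w => \sum_(i < m.+1) ('C(m, i)%:R * (Y w ^+ (m - i) * Z w ^+ i))%:E).
  apply/funext => w; rewrite exprDn sumEFin; congr EFin.
  by apply: eq_bigr => i _; rewrite mulr_natl.
apply: integrable_sum => // i _.
under eq_fun do rewrite EFinM.
by apply: integrableZl => //; exact: integrable_mul_moments.
Qed.

Lemma all_momentsZ c Z : all_moments Z -> all_moments (fun w => c * Z w).
Proof. by move=> mZ; apply: all_momentsM => //; exact: all_moments_cst. Qed.

Lemma all_moments_sum I (r : seq I) (Z : I -> T -> R) : (forall i, all_moments (Z i)) ->
  all_moments (fun w => \sum_(i <- r) Z i w).
Proof.
move=> mZ; elim: r => [|i r IHr].
  by under eq_fun do rewrite big_nil; exact: all_moments_cst.
by under eq_fun do rewrite big_cons; exact: all_momentsD.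
Qed.

Lemma all_momentsX Z k : all_moments Z -> all_moments (fun w => Z w ^+ k).
Proof.
move=> mZ m; have := mZ (k * m)%N.
by congr (P.-integrable _ _); apply/funext => w; rewrite exprM.
Qed.

Lemma all_moments_eq Y Z : Y =1 Z -> all_moments Y -> all_moments Z.
Proof. by move=> /funext ->. Qed.

Local Notation E Z := (\int[P]_w Z w).

Lemma expD Y Z : all_moments Y -> all_moments Z -> \int[P]_w (Y w + Z w) = E Y + E Z.
Proof. by move=> mY mZ; rewrite RintegralD //; exact: all_moments_integrable. Qed.

Lemma expZ c Z : all_moments Z -> \int[P]_w (c * Z w) = c * E Z.
Proof. by move=> mZ; rewrite RintegralZl //; exact: all_moments_integrable. Qed.

Lemma exp_sum I (r : seq I) (Z : I -> T -> R) : (forall i, all_moments (Z i)) ->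
  \int[P]_w (\sum_(i <- r) Z i w) = \sum_(i <- r) E (Z i).
Proof.
move=> mZ; elim: r => [|i r IHr].
  under eq_Rintegral do rewrite big_nil.
  by rewrite big_nil Rintegral_cst // mul0r.
under eq_Rintegral do rewrite big_cons.
by rewrite big_cons -IHr expD //; exact: all_moments_sum.
Qed.

Lemma exp_le Y Z : all_moments Y -> all_moments Z -> (forall w, Y w <= Z w) -> E Y <= E Z.
Proof. by move=> mY mZ YZ; apply: le_Rintegral => //; exact: all_moments_integrable. Qed.

(* Interpolation at [0, ..., N - 1]: the Vandermonde matrix is invertible. *)
Lemma coef1_lincomb N : exists lam : 'I_N -> R, forall q : {poly R}, (size q <= N)%N ->
  q`_1 = \sum_(k < N) lam k * q.[k%:R].
Proof.
pose a : 'rV[R]_N := \row_k k%:R.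
have Vu : Vandermonde N a \in unitmx.
  rewrite unitmxE det_Vandermonde unitfE; apply/prodf_neq0 => i _.
  apply/prodf_neq0 => j ij; rewrite !mxE subr_eq0 eqr_nat gt_eqF //.
(* For N <= 1 there is no row of index 1, but then the coefficient of degree 1 vanishes and zero
   weights are right. *)
pose lam k := if insub 1%N is Some i then invmx (Vandermonde N a) k i else 0.
exists lam => q qN.
transitivity (\sum_(i < N) q`_i * \sum_(k < N) lam k * k%:R ^+ i); last first.
  under eq_bigr do rewrite mulr_sumr.
  rewrite exchange_big /=; apply: eq_bigr => k _.
  rewrite (horner_coef_wide _ qN) mulr_sumr; apply: eq_bigr => i _.
  by rewrite mulrCA.
rewrite /lam; case: insubP => [i _ iE|].
  have E (l : 'I_N) : \sum_(k < N) invmx (Vandermonde N a) k i * k%:R ^+ l = (l == i)%:R.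
    have /(congr1 (fun M : 'M[R]_N => M l i)) := mulmxV Vu; rewrite !mxE => <-.
    by apply: eq_bigr => k _; rewrite !mxE mulrC.
  under eq_bigr do rewrite E.
  rewrite (bigD1 i) //= eqxx mulr1 big1 ?addr0 ?iE // => l /negbTE ->.
  by rewrite mulr0.
rewrite -leqNgt => N1; rewrite nth_default ?(leq_trans qN) //.
by rewrite big1 // => i _; rewrite big1 ?mulr0 // => k _; rewrite mul0r.
Qed.

(* Identities between expectations of polynomials in a parameter [s] may be
   differentiated at [s = 0]. *)
Lemma exp_poly_coef1 N (p q : T -> {poly R}) :
  (forall w, size (p w) <= N)%N -> (forall w, size (q w) <= N)%N ->
  (forall s, all_moments (fun w => (p w).[s])) ->
  (forall s, all_moments (fun w => (q w).[s])) ->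
  (forall s, \int[P]_w (p w).[s] = \int[P]_w (q w).[s]) ->
  \int[P]_w (p w)`_1 = \int[P]_w (q w)`_1.
Proof.
move=> pN qN mp mq pq; have [lam lamE] := coef1_lincomb N.
have -> : (fun w => (p w)`_1) = (fun w => \sum_(k < N) lam k * (p w).[k%:R]).
  by apply/funext => w; exact: lamE.
have -> : (fun w => (q w)`_1) = (fun w => \sum_(k < N) lam k * (q w).[k%:R]).
  by apply/funext => w; exact: lamE.
rewrite !exp_sum; [|by move=> k; exact: all_momentsZ..].
by apply: eq_bigr => k _; rewrite !expZ // pq.
Qed.

End NormalLaw.

(** * Stein's identity for Gaussian vectors *)

Set Implicit Arguments.

Section PolynomialCoefficients.
Context {R : comNzRingType}.
Implicit Types p q : {poly R}.

Lemma coef1M p q : (p * q)`_1 = p`_0 * q`_1 + p`_1 * q`_0.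
Proof. by rewrite coefM !big_ord_recl big_ord0 addr0. Qed.

Lemma coef0X p k : (p ^+ k)`_0 = p`_0 ^+ k.
Proof. by rewrite -!horner_coef0 horner_exp. Qed.

Lemma coef1X p k : (p ^+ k)`_1 = k%:R * p`_0 ^+ k.-1 * p`_1.
Proof.
elim: k => [|k IHk]; first by rewrite expr0 coef1 !mul0r.
rewrite exprS coef1M IHk coef0X; case: k {IHk} => [|k] /=.
  by rewrite !(mul0r, mulr0, expr0, add0r, mulr1, mul1r).
by rewrite (exprS _ k) -[k.+2]addn1 natrD; ring.
Qed.

End PolynomialCoefficients.

Section GaussianVector.
Context {R : realType} {d} {T : measurableType d} (P : probability T R).
Context {p : nat} (X : T -> 'cV[R]_p) (Psi : 'M[R]_p).
Hypotheses (symPsi : Psi^T = Psi) (posPsi : forall v, v != 0 -> 0 < dot v (Psi *m v)).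
Hypothesis lawX : has_mvnormal0_law P X Psi.
Implicit Types (t u v y : 'cV[R]_p).

Lemma dot_normal_law v : v != 0 ->
  has_normal_law P (fun w => dot v (X w)) 0 (dot v (Psi *m v)).
Proof. by move=> v0; have := lawX v v0; rewrite /dot mulmxA. Qed.

Lemma all_moments_dot t : all_moments P (fun w => dot t (X w)).
Proof.
have [->|t0] := eqVneq t 0.
  by apply: (all_moments_eq _ (cst 0)); [move=> w; rewrite dot0l | exact: all_moments_cst].
apply: (normal_law_all_moments P (fun w => dot t (X w)) (dot t (Psi *m t))).
  exact: dot_normal_law.
exact: posPsi.
Qed.

Lemma moment_dot t m : \int[P]_w (dot t (X w) ^+ m.+1) =
  m%:R * dot t (Psi *m t) * \int[P]_w (dot t (X w) ^+ m.-1).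
Proof.
have [->|t0] := eqVneq t 0; last first.
  apply: (normal_law_moment P (fun w => dot t (X w)) (dot t (Psi *m t))).
    exact: dot_normal_law.
  exact: posPsi.
under eq_Rintegral do rewrite dot0l expr0n.
by rewrite dot0l mulr0 !mul0r Rintegral_cst // mul0r.
Qed.

Lemma dot_PsiC t u : dot t (Psi *m u) = dot u (Psi *m t).
Proof. by rewrite dot_mulmxr symPsi dotC. Qed.

Local Notation lin a b := (Poly [:: a; b]).

Lemma size_lin_exp (a b : R) k : (size (lin a b ^+ k) <= k.+1)%N.
Proof.
rewrite (leq_trans (size_poly_exp_leq _ _)) // ltnS.
have := size_Poly [:: a; b]; rewrite /=; case: (size _) => [|[|[|?]]] //=; lia.
Qed.

Lemma horner_lin (a b s : R) : (lin a b).[s] = a + s * b.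
Proof. by rewrite horner_Poly /= mul0r add0r addrC mulrC. Qed.

(** Differentiate the scalar recursion [moment_dot] at t in the direction u. The derivative of the
    variance gives the term in [dot t (Psi *m u)]; the derivative of the remaining power is an
    instance of the claim at m - 2, hence the strong induction. *)
Lemma stein_pow m : forall t u,
  \int[P]_w (dot u (X w) * dot t (X w) ^+ m) =
  m%:R * dot t (Psi *m u) * \int[P]_w (dot t (X w) ^+ m.-1).
Proof.
elim/ltn_ind: m => m IHm t u.
pose a w := dot t (X w); pose b w := dot u (X w).
have ma : all_moments P a by exact: all_moments_dot.
have mb : all_moments P b by exact: all_moments_dot.
pose c0 := dot t (Psi *m t); pose c1 := dot t (Psi *m u); pose c2 := dot u (Psi *m u).
pose p1 w := lin (a w) (b w) ^+ m.+1.
pose p2 w := Poly [:: m%:R * c0; m%:R * (2 * c1); m%:R * c2] * lin (a w) (b w) ^+ m.-1.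
have dotD s w : a w + s * b w = dot (t + s *: u) (X w) by rewrite dotDl dotZl.
have p1E s w : (p1 w).[s] = dot (t + s *: u) (X w) ^+ m.+1.
  by rewrite /p1 horner_exp horner_lin dotD.
have cE s : (m%:R * c0 + s * (m%:R * (2 * c1)) + s ^+ 2 * (m%:R * c2)) =
    m%:R * dot (t + s *: u) (Psi *m (t + s *: u)).
  rewrite mulmxDr -scalemxAr !(dotDl, dotDr, dotZl, dotZr) (dot_PsiC u t).
  by rewrite /c0 /c1 /c2; ring.
have p2E s w : (p2 w).[s] =
    m%:R * dot (t + s *: u) (Psi *m (t + s *: u)) * dot (t + s *: u) (X w) ^+ m.-1.
  rewrite /p2 hornerM horner_exp horner_lin dotD -cE horner_Poly /=; congr (_ * _).
  by ring.
have := @exp_poly_coef1 _ _ _ P m.+3 p1 p2.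
have -> : (fun w => (p1 w)`_1) = (fun w => m.+1%:R * (b w * a w ^+ m)).
  by apply/funext => w; rewrite /p1 coef1X !coef_Poly /=; ring.
have -> : (fun w => (p2 w)`_1) = (fun w => m%:R * c0 * m.-1%:R * (b w * a w ^+ m.-2) +
    m%:R * (2 * c1) * a w ^+ m.-1).
  by apply/funext => w; rewrite /p2 coef1M coef1X coef0X !coef_Poly /=; ring.
move=> /(_ _ _ _ _ _)/wrap[].
- by move=> w; rewrite (leq_trans (size_lin_exp _ _ _)).
- move=> w; rewrite (leq_trans (size_polyMleq _ _)) //.
  have := size_Poly [:: m%:R * c0; m%:R * (2 * c1); m%:R * c2].
  by have := size_lin_exp (a w) (b w) m.-1; rewrite /=; lia.
- move=> s; apply: (all_moments_eq _ (fun w => dot (t + s *: u) (X w) ^+ m.+1)) => //.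
  by apply: all_momentsX; exact: all_moments_dot.
- move=> s; apply: (all_moments_eq _ (fun w => m%:R * dot (t + s *: u) (Psi *m (t + s *: u)) *
    dot (t + s *: u) (X w) ^+ m.-1)) => //.
  by apply: all_momentsZ; apply: all_momentsX; exact: all_moments_dot.
- move=> s; under eq_Rintegral do rewrite p1E.
  under [RHS]eq_Rintegral do rewrite p2E.
  by rewrite moment_dot expZ //; apply: all_momentsX; exact: all_moments_dot.
have mX k : all_moments P (fun w => a w ^+ k) by exact: all_momentsX.
have mbX k : all_moments P (fun w => b w * a w ^+ k) by exact: all_momentsM.
rewrite expD ?expZ //; [|exact: all_momentsZ..].
have m1 : m.+1%:R != 0 :> R by rewrite pnatr_eq0.
move=> h; apply: (mulfI m1); rewrite h.
case: m IHm m1 {h mX mbX p1 p2 p1E p2E cE} => [|[|m]] IHm m1 /=.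
- by rewrite !mul0r mulr0 addr0.
- by rewrite mulr0 !mul0r add0r /c1; ring.
have := IHm m (ltnW (leqnn _)) t u; rewrite -/(a _) -/(b _) => ->.
have := moment_dot t m.+1; rewrite moment_dot /= -/c0 -/c1.
have := moment_dot t m; rewrite -/c0 => ->.
by move=> _; ring.
Qed.

Fixpoint prod_dot (ts : seq 'cV[R]_p) y : R :=
  if ts is t :: ts' then dot t y * prod_dot ts' y else 1.

Fixpoint Dprod_dot (ts : seq 'cV[R]_p) y v : R :=
  if ts is t :: ts' then dot t v * prod_dot ts' y + dot t y * Dprod_dot ts' y v else 0.

Lemma all_moments_prod_dot ts : all_moments P (fun w => prod_dot ts (X w)).
Proof.
elim: ts => [|t ts IHts] /=; first exact: all_moments_cst.
by apply: all_momentsM => //; exact: all_moments_dot.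
Qed.

Lemma all_moments_Dprod_dot ts v : all_moments P (fun w => Dprod_dot ts (X w) v).
Proof.
elim: ts => [|t ts IHts] /=; first exact: all_moments_cst.
apply: all_momentsD; first by apply: all_momentsZ; exact: all_moments_prod_dot.
by apply: all_momentsM => //; exact: all_moments_dot.
Qed.

(* Polarization: the coefficient of [s] in the identity for [t + s t'] turns
   one power of [t] into the factor [t']. *)
Lemma stein_pow_prod ts : forall m t u,
  \int[P]_w (dot u (X w) * (dot t (X w) ^+ m * prod_dot ts (X w))) =
  \int[P]_w (m%:R * dot t (Psi *m u) * (dot t (X w) ^+ m.-1 * prod_dot ts (X w)) +
             dot t (X w) ^+ m * Dprod_dot ts (X w) (Psi *m u)).
Proof.
elim: ts => [|t' ts IHts] m t u.
  rewrite /=; under eq_Rintegral do rewrite mulr1.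
  under [RHS]eq_Rintegral do rewrite mulr1 mulr0 addr0.
  by rewrite stein_pow expZ //; apply: all_momentsX; exact: all_moments_dot.
pose a w := dot t (X w); pose a' w := dot t' (X w); pose b w := dot u (X w).
pose f w := prod_dot ts (X w); pose Df w := Dprod_dot ts (X w) (Psi *m u).
have ma : all_moments P a by exact: all_moments_dot.
have ma' : all_moments P a' by exact: all_moments_dot.
have mb : all_moments P b by exact: all_moments_dot.
have mf : all_moments P f by exact: all_moments_prod_dot.
have mDf : all_moments P Df by exact: all_moments_Dprod_dot.
pose c := dot t (Psi *m u); pose c' := dot t' (Psi *m u).
pose p1 w := (b w * f w) *: lin (a w) (a' w) ^+ m.+1.
pose p2 w := (m.+1%:R * f w) *: (lin c c' * lin (a w) (a' w) ^+ m) +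
   Df w *: lin (a w) (a' w) ^+ m.+1.
have dotD s w : a w + s * a' w = dot (t + s *: t') (X w) by rewrite dotDl dotZl.
have cE s : c + s * c' = dot (t + s *: t') (Psi *m u) by rewrite dotDl dotZl.
have p1E s w : (p1 w).[s] = b w * (dot (t + s *: t') (X w) ^+ m.+1 * f w).
  by rewrite /p1 hornerZ horner_exp horner_lin dotD; ring.
have p2E s w : (p2 w).[s] =
    m.+1%:R * dot (t + s *: t') (Psi *m u) * (dot (t + s *: t') (X w) ^+ m * f w) +
    dot (t + s *: t') (X w) ^+ m.+1 * Df w.
  by rewrite /p2 hornerD !hornerZ hornerM !horner_exp !horner_lin dotD cE; ring.
have := @exp_poly_coef1 _ _ _ P m.+4 p1 p2.
have -> : (fun w => (p1 w)`_1) = (fun w => m.+1%:R * (b w * (a w ^+ m * (a' w * f w)))).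
  by apply/funext => w; rewrite /p1 coefZ coef1X !coef_Poly /=; ring.
have -> : (fun w => (p2 w)`_1) = (fun w => m.+1%:R * (m%:R * c * (a w ^+ m.-1 * (a' w * f w)) +
    a w ^+ m * (c' * f w + a' w * Df w))).
  apply/funext => w; rewrite /p2 coefD !coefZ coef1M !coef1X !coef0X !coef_Poly /=.
  by ring.
have mL s k : all_moments P (fun w => dot (t + s *: t') (X w) ^+ k).
  by apply: all_momentsX; exact: all_moments_dot.
have mak k : all_moments P (fun w => a w ^+ k) by exact: all_momentsX.
move=> /(_ _ _ _ _ _)/wrap[].
- move=> w; apply: (leq_trans (size_scale_leq _ _)).
  by apply: (leq_trans (size_lin_exp _ _ _)); lia.
- move=> w; rewrite (leq_trans (size_polyD _ _)) // geq_max.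
  apply/andP; split; last first.
    apply: (leq_trans (size_scale_leq _ _)).
    by apply: (leq_trans (size_lin_exp _ _ _)); lia.
  apply: (leq_trans (size_scale_leq _ _)); apply: (leq_trans (size_polyMleq _ _)).
  have := size_Poly [:: c; c'].
  by have := size_lin_exp (a w) (a' w) m; rewrite /=; lia.
- move=> s; apply: (all_moments_eq _ (fun w => b w * (dot (t + s *: t') (X w) ^+ m.+1 * f w))) => //.
  by apply: all_momentsM => //; exact: all_momentsM.
- move=> s; apply: (all_moments_eq _ (fun w =>
    m.+1%:R * dot (t + s *: t') (Psi *m u) * (dot (t + s *: t') (X w) ^+ m * f w) +
    dot (t + s *: t') (X w) ^+ m.+1 * Df w)) => //.
  by apply: all_momentsD; [apply: all_momentsZ; exact: all_momentsM | exact: all_momentsM].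
- move=> s; under eq_Rintegral do rewrite p1E.
  by under [RHS]eq_Rintegral do rewrite p2E; exact: IHts.
rewrite !expZ; first by apply: mulfI; rewrite pnatr_eq0.
- apply: all_momentsD; first by apply: all_momentsZ; apply: all_momentsM => //; exact: all_momentsM.
  apply: all_momentsM => //; apply: all_momentsD; [exact: all_momentsZ | exact: all_momentsM].
- by apply: all_momentsM => //; apply: all_momentsM => //; exact: all_momentsM.
Qed.

(* [polyfun f Df]: [f] is a polynomial function with differential [Df]. *)
Inductive polyfun : ('cV[R]_p -> R) -> ('cV[R]_p -> 'cV[R]_p -> R) -> Prop :=
| polyfun_cst c : polyfun (fun=> c) (fun _ _ => 0)
| polyfun_dot t f Df : polyfun f Df ->
    polyfun (fun y => dot t y * f y) (fun y v => dot t v * f y + dot t y * Df y v)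
| polyfunD f Df g Dg : polyfun f Df -> polyfun g Dg ->
    polyfun (fun y => f y + g y) (fun y v => Df y v + Dg y v).

Lemma polyfun_eq f Df g Dg : polyfun f Df -> f =1 g -> (forall y v, Df y v = Dg y v) ->
  polyfun g Dg.
Proof.
move=> pf /funext <- DD; suff -> : Dg = Df by [].
by apply/funext => y; apply/funext => v.
Qed.

Lemma polyfunZ c f Df : polyfun f Df -> polyfun (fun y => c * f y) (fun y v => c * Df y v).
Proof.
elim=> [c'|t g Dg _ IH|g Dg h Dh _ IHg _ IHh].
- by apply: polyfun_eq (polyfun_cst (c * c')) _ _ => // y v; rewrite mulr0.
- by apply: polyfun_eq (polyfun_dot t IH) _ _ => y * /=; ring.
- by apply: polyfun_eq (polyfunD IHg IHh) _ _ => y * /=; ring.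
Qed.

Lemma polyfunM f Df g Dg : polyfun f Df -> polyfun g Dg ->
  polyfun (fun y => f y * g y) (fun y v => Df y v * g y + f y * Dg y v).
Proof.
move=> + pg; elim=> [c|t h Dh _ IH|h Dh k Dk _ IHh _ IHk].
- by apply: polyfun_eq (polyfunZ c pg) _ _ => y * /=; ring.
- by apply: polyfun_eq (polyfun_dot t IH) _ _ => y * /=; ring.
- by apply: polyfun_eq (polyfunD IHh IHk) _ _ => y * /=; ring.
Qed.

Lemma polyfun_sum I (r : seq I) (f : I -> 'cV[R]_p -> R) Df :
  (forall i, polyfun (f i) (Df i)) ->
  polyfun (fun y => \sum_(i <- r) f i y) (fun y v => \sum_(i <- r) Df i y v).
Proof.
move=> pf; elim: r => [|i r IHr].
  by apply: polyfun_eq (polyfun_cst 0) _ _ => y *; rewrite big_nil.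
by apply: polyfun_eq (polyfunD (pf i) IHr) _ _ => y *; rewrite big_cons.
Qed.

Lemma all_moments_polyfun f Df : polyfun f Df ->
  all_moments P (fun w => f (X w)) /\ forall v, all_moments P (fun w => Df (X w) v).
Proof.
elim=> [c|t g Dg _ [mg mDg]|g Dg h Dh _ [mg mDg] _ [mh mDh]].
- by split => [|v]; exact: all_moments_cst.
- have mt := all_moments_dot t; split => [|v]; first exact: all_momentsM.
  by apply: all_momentsD; [exact: all_momentsZ | exact: all_momentsM].
- by split => [|v]; exact: all_momentsD.
Qed.

(** Gaussian integration by parts for polynomial functions of the whole vector, the tool for the
    moments of quadratic forms. *)
Lemma stein f Df u : polyfun f Df ->
  \int[P]_w (dot u (X w) * f (X w)) = \int[P]_w (Df (X w) (Psi *m u)).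
Proof.
(* The claim is strengthened by a prefix product [ts]: the constructor [polyfun_dot] moves its
   factor into the prefix, until only a constant is left beside it. *)
move=> pf; suff h ts : \int[P]_w (dot u (X w) * (prod_dot ts (X w) * f (X w))) =
    \int[P]_w (Dprod_dot ts (X w) (Psi *m u) * f (X w) + prod_dot ts (X w) * Df (X w) (Psi *m u)).
  have := h [::]; rewrite /=; under eq_Rintegral do rewrite mul1r.
  by under [RHS]eq_Rintegral do rewrite mul0r add0r mul1r.
elim: pf ts => [c|t g Dg pg IH|g Dg k Dk pg IHg pk IHk] ts.
- have mD := all_moments_Dprod_dot ts (Psi *m u).
  have mp := all_moments_prod_dot ts; have mu := all_moments_dot u.
  (* A dummy zeroth power of the zero form brings the product to the shape of [stein_pow_prod]. *)
  transitivity (\int[P]_w (c * (dot u (X w) * (dot 0 (X w) ^+ 0 * prod_dot ts (X w))))).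
    by apply: eq_Rintegral => w _; ring.
  rewrite expZ; last first.
    by apply: all_momentsM => //; apply: all_momentsM => //; exact: all_moments_cst.
  rewrite stein_pow_prod -expZ; last first.
    apply: all_momentsD; first apply: all_momentsZ; apply: all_momentsM => //; exact: all_moments_cst.
  by apply: eq_Rintegral => w _; rewrite /= expr0; ring.
- have := IH (t :: ts); rewrite /= => h.
  transitivity (\int[P]_w (dot u (X w) * (dot t (X w) * prod_dot ts (X w) * g (X w)))).
    by apply: eq_Rintegral => w _; ring.
  by rewrite h; apply: eq_Rintegral => w _; ring.
- have mD := all_moments_Dprod_dot ts (Psi *m u).
  have mp := all_moments_prod_dot ts; have mu := all_moments_dot u.
  have [mg mDg] := all_moments_polyfun pg; have [mk mDk] := all_moments_polyfun pk.
  transitivity (\int[P]_w (dot u (X w) * (prod_dot ts (X w) * g (X w)) +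
     dot u (X w) * (prod_dot ts (X w) * k (X w)))).
    by apply: eq_Rintegral => w _; ring.
  rewrite expD; [|by apply: all_momentsM => //; exact: all_momentsM..].
  rewrite IHg IHk -expD; [|by apply: all_momentsD; exact: all_momentsM..].
  by apply: eq_Rintegral => w _; ring.
Qed.

Lemma dot_delta i y : dot (delta_mx i 0) y = y i 0.
Proof. by rewrite /dot trmx_delta -rowE mxE. Qed.

Lemma dot_delta_sum x y : dot x y = \sum_i dot (delta_mx i 0) x * dot (delta_mx i 0) y.
Proof. by rewrite dotE; apply: eq_bigr => i _; rewrite !dot_delta. Qed.

Lemma polyfun_quad (A : 'M[R]_p) c :
  polyfun (fun y => dot y (A *m y) - c) (fun y v => dot v (A *m y) + dot y (A *m v)).
Proof.
pose e i : 'cV[R]_p := delta_mx i 0.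
have pi i := polyfun_dot (e i) (polyfun_dot (A^T *m e i) (polyfun_cst 1)).
pose f i y := dot (e i) y * (dot (A^T *m e i) y * 1).
pose Df i y v := dot (e i) v * (dot (A^T *m e i) y * 1) +
  dot (e i) y * (dot (A^T *m e i) v * 1 + dot (A^T *m e i) y * 0).
have ps := @polyfun_sum _ (index_enum 'I_p) f Df pi.
apply: polyfun_eq (polyfunD ps (polyfun_cst (- c))) _ _ => [y|y v /=].
  rewrite [in RHS]dot_delta_sum; congr (_ - _); apply: eq_bigr => i _.
  by rewrite /f mulr1 dot_mulmxr.
rewrite addr0 [in RHS]dot_delta_sum [dot y (A *m v)]dot_delta_sum -big_split.
by apply: eq_bigr => i _ /=; rewrite /Df -!/(e i) !(dot_mulmxr (e i) A); ring.
Qed.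

Lemma all_moments_quad (A : 'M[R]_p) c :
  all_moments P (fun w => dot (X w) (A *m X w) - c).
Proof. exact: (all_moments_polyfun (polyfun_quad A c)).1. Qed.

Lemma all_moments_sqnorm : all_moments P (fun w => dot (X w) (X w)).
Proof.
apply: (all_moments_eq P (fun w => dot (X w) (1%:M *m X w) - 0)); last exact: all_moments_quad.
by move=> w; rewrite mul1mx subr0.
Qed.

Section FourthMoment.
Variable A : 'M[R]_p.
Let F y := dot y (A *m y) - \tr (A *m Psi).
Let G y := dot (A *m y) (Psi *m (A *m y)) + dot (A^T *m y) (Psi *m (A *m y)).

(** One factor F is written as the sum of (e_i . X)(A^T e_i . X) minus its mean, and Stein's
    identity is applied to e_i . X. Differentiating A^T e_i . X gives the trace times E F^3, which
    cancels the mean; differentiating F^3 leaves 3 F^2 times the derivative of F along Psi A X, and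
    that is G. *)
Lemma fourth_moment_stein :
  \int[P]_w (F (X w) ^+ 4) = 3 * \int[P]_w (F (X w) ^+ 2 * G (X w)).
Proof.
pose e i : 'cV[R]_p := delta_mx i 0; pose c := \tr (A *m Psi).
pose DF y v := dot v (A *m y) + dot y (A *m v).
have pF : polyfun F DF by exact: polyfun_quad.
pose f i y := dot (A^T *m e i) y * (F y * F y * F y).
have pf i := polyfunM (polyfun_dot (A^T *m e i) (polyfun_cst 1)) (polyfunM (polyfunM pF pF) pF).
have mF := (all_moments_polyfun pF).1.
have mF3 : all_moments P (fun w => F (X w) ^+ 3) by exact: all_momentsX.
have meF i : all_moments P (fun w => dot (e i) (X w) * (dot (A^T *m e i) (X w) * F (X w) ^+ 3)).
  apply: all_momentsM; first exact: all_moments_dot.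
  by apply: all_momentsM => //; exact: all_moments_dot.
have mG : all_moments P (fun w => F (X w) ^+ 2 * G (X w)).
  apply: all_momentsM; first exact: all_momentsX.
  apply: (all_moments_eq P (fun w => dot (X w) ((A^T *m Psi *m A + A *m Psi *m A) *m X w) - 0)).
    move=> w; rewrite subr0 mulmxDl dotDr /G -!mulmxA; congr (_ + _).
      by rewrite (dot_mulmxr _ A^T) trmxK.
    by rewrite dot_mulmxr.
  exact: all_moments_quad.
transitivity (\int[P]_w (\sum_i dot (e i) (X w) * (dot (A^T *m e i) (X w) * F (X w) ^+ 3) +
    (- c) * F (X w) ^+ 3)).
  apply: eq_Rintegral => w _; rewrite exprS {1}/F mulrDl; congr (_ + _).
  rewrite dot_delta_sum mulr_suml; apply: eq_bigr => i _.
  by rewrite (dot_mulmxr (delta_mx i 0) A) mulrA.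
rewrite expD; [|exact: all_moments_sum|exact: all_momentsZ].
rewrite exp_sum // expZ //.
have E i : \int[P]_w (dot (e i) (X w) * (dot (A^T *m e i) (X w) * F (X w) ^+ 3)) =
    dot (A^T *m e i) (Psi *m e i) * \int[P]_w (F (X w) ^+ 3) +
    \int[P]_w (3 * (F (X w) ^+ 2 * (dot (A^T *m e i) (X w) * DF (X w) (Psi *m e i)))).
  have mD : all_moments P (fun w => DF (X w) (Psi *m e i)).
    exact: (all_moments_polyfun pF).2.
  transitivity (\int[P]_w (dot (e i) (X w) * (dot (A^T *m e i) (X w) * 1 * (F (X w) * F (X w) * F (X w))))).
    by apply: eq_Rintegral => w _; ring.
  rewrite (stein (e i) (pf i)) -expZ // -expD; last 2 first.
  - exact: all_momentsZ.
  - apply: all_momentsZ; apply: all_momentsM; first exact: all_momentsX.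
    by apply: all_momentsM => //; exact: all_moments_dot.
  by apply: eq_Rintegral => w _ /=; ring.
under eq_bigr do rewrite E.
rewrite big_split /= -mulr_suml.
have -> : \sum_i dot (A^T *m e i) (Psi *m e i) = c.
  by rewrite /c trace_dot; apply: eq_bigr => i _; rewrite -mulmxA (dot_mulmxr _ A).
rewrite addrAC mulNr subrr add0r -exp_sum; last first.
  move=> i; apply: all_momentsZ; apply: all_momentsM; first exact: all_momentsX.
  apply: all_momentsM; [exact: all_moments_dot | exact: (all_moments_polyfun pF).2].
rewrite -expZ //; apply: eq_Rintegral => w _.
rewrite -mulr_sumr -mulr_sumr; congr (3 * (_ * _)).
set y := X w.
have DFs v : DF y (Psi *m v) = dot (Psi *m (A *m y + A^T *m y)) v.
  rewrite /DF mulmxDr dotDl; congr (_ + _).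
    by rewrite dotC dot_mulmxr symPsi.
  by rewrite (dot_mulmxr y A) dot_mulmxr symPsi.
transitivity (dot (Psi *m (A *m y + A^T *m y)) (A *m y)).
  rewrite [RHS]dot_delta_sum; apply: eq_bigr => i _.
  by rewrite DFs (dot_mulmxr (delta_mx i 0) A) mulrC (dotC _ (e i)).
by rewrite mulmxDr dotDl /G [X in X + _]dotC [X in _ + X = _]dotC !(dot_PsiC (A *m y)).
Qed.

(* With [E F^4 = 3 E (F^2 G)], absorb [F^4 / 2] from AM-GM. *)
Lemma fourth_moment_le g : 0 <= g -> (forall y, `|G y| <= g * dot y y) ->
  \int[P]_w (F (X w) ^+ 4) <= 9 * g ^+ 2 * \int[P]_w (dot (X w) (X w) ^+ 2).
Proof.
move=> g0 Gg.
have mF : all_moments P (fun w => F (X w)) by exact: all_moments_quad.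
have mG : all_moments P (fun w => G (X w)).
  apply: (all_moments_eq P (fun w => dot (X w) ((A^T *m Psi *m A + A *m Psi *m A) *m X w) - 0)).
    move=> w; rewrite subr0 mulmxDl dotDr /G -!mulmxA; congr (_ + _).
      by rewrite (dot_mulmxr _ A^T) trmxK.
    by rewrite dot_mulmxr.
  exact: all_moments_quad.
have mF4 : all_moments P (fun w => F (X w) ^+ 4) by exact: all_momentsX.
have mN : all_moments P (fun w => dot (X w) (X w) ^+ 2).
  by apply: all_momentsX; exact: all_moments_sqnorm.
have mFG : all_moments P (fun w => F (X w) ^+ 2 * G (X w)).
  by apply: all_momentsM => //; exact: all_momentsX.
have : \int[P]_w (3 * (F (X w) ^+ 2 * G (X w))) <=
    \int[P]_w (2^-1 * F (X w) ^+ 4 + 9 / 2 * g ^+ 2 * dot (X w) (X w) ^+ 2).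
  apply: exp_le; [exact: all_momentsZ|by apply: all_momentsD; exact: all_momentsZ|].
  move=> w; have G2 : G (X w) ^+ 2 <= g ^+ 2 * dot (X w) (X w) ^+ 2.
    rewrite -exprMn -(real_normK (num_real (G (X w)))) lerXn2r ?nnegrE //.
    by rewrite mulr_ge0 ?dot_ge0.
  have := sqr_ge0 (F (X w) ^+ 2 - 3 * G (X w)); rewrite sqrrB -exprM exprMn; lra.
rewrite expZ // expD; [|exact: all_momentsZ..].
rewrite -fourth_moment_stein !expZ //; lra.
Qed.

End FourthMoment.

(** By Cauchy-Schwarz |X|^4 is at most p times the sum of the X_i^4, and a centred normal variable
    of variance v has fourth moment 3 v^2. *)
Lemma sqnorm_moment_le c : (forall y, dot y (Psi *m y) <= c * dot y y) -> 0 <= c ->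
  \int[P]_w (dot (X w) (X w) ^+ 2) <= 3 * (c * p%:R) ^+ 2.
Proof.
move=> Psic c0; pose a i w := dot (delta_mx i 0) (X w) ^+ 2.
have ma i k : all_moments P (fun w => dot (delta_mx i 0) (X w) ^+ k).
  by apply: all_momentsX; exact: all_moments_dot.
have mN : all_moments P (fun w => dot (X w) (X w) ^+ 2).
  by apply: all_momentsX; exact: all_moments_sqnorm.
have ms : all_moments P (fun w => \sum_i dot (delta_mx i 0) (X w) ^+ 4).
  by apply: all_moments_sum => i.
have E4 i : \int[P]_w (dot (delta_mx i 0) (X w) ^+ 4) <= 3 * c ^+ 2.
  rewrite !moment_dot /=; under eq_Rintegral do rewrite expr0.
  have -> : \int[P]_w (1 : R) = 1.
    by rewrite Rintegral_cst // mul1r; exact: (congr1 fine (probability_setT P)).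
  have := Psic (delta_mx i 0); rewrite -!sqr_nrm nrm_delta expr1n mulr1.
  have q0 : 0 <= dot (delta_mx i 0) (Psi *m delta_mx i 0).
    have [->|n0] := eqVneq (delta_mx i 0 : 'cV[R]_p) 0; first by rewrite dot0l.
    exact: ltW (posPsi _ n0).
  by move: q0; set q := dot _ _ => q0 qc; rewrite mulr1 mul1r -mulrA ler_wpM2l // -expr2 lerXn2r ?nnegrE.
apply: (@le_trans _ _ (\int[P]_w (p%:R * \sum_i dot (delta_mx i 0) (X w) ^+ 4))).
  apply: exp_le => //; first exact: all_momentsZ.
  move=> w; rewrite dot_delta_sum.
  under eq_bigr do rewrite -expr2.
  have -> : \sum_i dot (delta_mx i 0) (X w) ^+ 4 = \sum_i a i w ^+ 2.
    by apply: eq_bigr => i _; rewrite /a -exprM.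
  pose u : 'cV[R]_p := const_mx 1; pose v : 'cV[R]_p := \col_i a i w.
  have := dot_le_nrm u v; rewrite -ler_sqr ?nnegrE ?mulr_ge0 ?nrm_ge0 //.
  rewrite exprMn !sqr_nrm real_normK ?num_real // !dotE.
  have -> : \sum_i u i 0 * v i 0 = \sum_i a i w by apply: eq_bigr => i _; rewrite !mxE mul1r.
  have -> : \sum_i u i 0 * u i 0 = p%:R.
    by rewrite -[p in RHS]card_ord -sumr_const; apply: eq_bigr => i _; rewrite !mxE mul1r.
  by have -> : \sum_i v i 0 * v i 0 = \sum_i a i w ^+ 2 by apply: eq_bigr => i _; rewrite !mxE.
rewrite expZ // exp_sum // (@le_trans _ _ (p%:R * \sum_(i < p) (3 * c ^+ 2))) //.
  by rewrite ler_wpM2l // ler_sum.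
by rewrite sumr_const card_ord -mulr_natl exprMn le_eqVlt; apply/orP; left; apply/eqP; ring.
Qed.

End GaussianVector.

(** * Measurability and independence of columns *)

Section MatrixMeasurability.
Context {R : realType} {d} {T : measurableType d}.

Definition measurable_mx {a b} (M : T -> 'M[R]_(a, b)) :=
  forall i k, measurable_fun setT (fun w => M w i k).

(** The inverse is x (x^2)^-1 with a real power, measurable on the whole line; at 0 both sides are
    0. *)
Lemma measurable_invr (f : T -> R) : measurable_fun setT f ->
  measurable_fun setT (fun w => (f w)^-1).
Proof.
move=> mf; have -> : (fun w => (f w)^-1) = (fun w => f w * ((f w ^+ 2) `^ (-1))).
  apply/funext => w; rewrite powR_inv1 ?sqr_ge0 //.
  have [->|f0] := eqVneq (f w) 0; first by rewrite mul0r invr0.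
  by field.
apply: measurable_funM => //.
apply: (measurableT_comp (f := fun x => x `^ (-1))); first exact: measurable_powR.
exact: measurable_funX.
Qed.

Lemma measurable_mx_cst {a b} (M : 'M[R]_(a, b)) : measurable_mx (fun=> M).
Proof. by move=> i k; exact: measurable_cst. Qed.

Lemma measurable_mxM {a b c} (M : T -> 'M[R]_(a, b)) (N : T -> 'M[R]_(b, c)) :
  measurable_mx M -> measurable_mx N -> measurable_mx (fun w => M w *m N w).
Proof.
move=> mM mN i k; under eq_fun do rewrite mxE.
by apply: measurable_sum => l; exact: measurable_funM.
Qed.

Lemma measurable_mxD {a b} (M N : T -> 'M[R]_(a, b)) :
  measurable_mx M -> measurable_mx N -> measurable_mx (fun w => M w + N w).
Proof.
by move=> mM mN i k; under eq_fun do rewrite mxE; exact: measurable_funD.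
Qed.

Lemma measurable_mx_tr {a b} (M : T -> 'M[R]_(a, b)) :
  measurable_mx M -> measurable_mx (fun w => (M w)^T).
Proof. by move=> mM i k; under eq_fun do rewrite mxE; exact: mM. Qed.

Lemma measurable_mx_sum {a b} I (r : seq I) (S : pred I) (M : I -> T -> 'M[R]_(a, b)) :
  (forall i, S i -> measurable_mx (M i)) ->
  measurable_mx (fun w => \sum_(i <- r | S i) M i w).
Proof.
move=> mM; elim: r => [|i r IHr].
  by under eq_fun do rewrite big_nil; exact: measurable_mx_cst.
have [Si|/negbTE Si] := boolP (S i).
  have -> : (fun w => \sum_(i <- i :: r | S i) M i w) =
      (fun w => M i w + \sum_(i <- r | S i) M i w).
    by apply/funext => w; rewrite big_cons Si.
  by apply: measurable_mxD => //; exact: mM.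
by have -> : (fun w => \sum_(i <- i :: r | S i) M i w) = (fun w => \sum_(i <- r | S i) M i w)
  by apply/funext => w; rewrite big_cons Si.
Qed.

Lemma measurable_det n (M : T -> 'M[R]_n) : measurable_mx M ->
  measurable_fun setT (fun w => \det (M w)).
Proof.
move=> mM; apply: measurable_sum => s; apply: measurable_funM => //.
by apply: measurable_prod => i _; exact: mM.
Qed.

(** Cramer's rule. Invertibility everywhere keeps [invmx] out of its default case, where it returns
    its argument. *)
Lemma measurable_invmx n (M : T -> 'M[R]_n) : measurable_mx M ->
  (forall w, M w \in unitmx) -> measurable_mx (fun w => invmx (M w)).
Proof.
move=> mM uM i k.
have -> : (fun w => invmx (M w) i k) = (fun w => (\det (M w))^-1 *
    ((-1) ^+ (k + i) * \det (row' k (col' i (M w))))).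
  by apply/funext => w; rewrite /invmx uM !mxE.
apply: measurable_funM; first by apply: measurable_invr; exact: measurable_det.
apply: measurable_funM => //; apply: measurable_det => a b.
by under eq_fun do rewrite !mxE; exact: mM.
Qed.

Lemma measurable_trace n (M : T -> 'M[R]_n) : measurable_mx M ->
  measurable_fun setT (fun w => \tr (M w)).
Proof. by move=> mM; apply: measurable_sum => i; exact: mM. Qed.

Lemma measurable_mx_comp d' (T' : measurableType d') (f : T' -> T) {a b}
    (M : T -> 'M[R]_(a, b)) i k : measurable_mx M -> measurable_fun setT f ->
  measurable_fun setT (fun w => M (f w) i k).
Proof. by move=> mM mf; exact: (measurableT_comp (mM i k) mf). Qed.

End MatrixMeasurability.

Section PiSystem.
Context {R : realType} {d} {T : measurableType d} (P : probability T R).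

Lemma pi_system_indep (G : set (set T)) (g : (set T)^nat) (A : set T) (c : \bar R) :
  G `<=` measurable -> setI_closed G -> (forall i, G (g i)) -> \bigcup_k g k = setT ->
  measurable A -> (0 <= c < +oo)%E ->
  (forall B, G B -> P (A `&` B) = c * P B)%E ->
  forall B, <<s G >> B -> P (A `&` B) = (P A * P B)%E.
Proof.
move=> Gm GI Gg gT mA /andP[c0 coo] AB.
have c_fin : c \is a fin_num by rewrite ge0_fin_numE.
pose c' : {nonneg R} := NngNum (fine_ge0 c0).
have cE B : mscale c' P B = (c * P B)%E by rewrite /mscale /= fineK.
have PA B : <<s G >> B -> P (A `&` B) = (c * P B)%E.
  move=> sB; rewrite -cE setIC -[LHS]/(mrestr P mA B).
  apply: (g_sigma_algebra_measure_unique G Gm g Gg gT) sB => //.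
    by move=> D GD; rewrite /= cE -AB // setIC.
  by move=> k; rewrite (le_lt_trans (probability_le1 _ _)) ?ltry //; apply: measurableI => //; exact: Gm.
move=> B sB; rewrite PA //; congr (_ * _)%E.
have := PA setT; rewrite setIT probability_setT mule1 => <- //.
exact: (@measurableT _ (g_sigma_algebraType G)).
Qed.

End PiSystem.

Section Independence.
Context {R : realType} {d} {T : measurableType d} (P : probability T R).
Context {p m : nat} (Y : T -> 'M[R]_(p, m)).
Hypothesis mY : measurable_mx Y.
Hypothesis indepY : indep_vectors P (fun j w => col j (Y w)).
Implicit Types (S : pred 'I_m) (t : 'I_m -> 'cV[R]_p).

(** The events of a joint distribution function restricted to the columns in S. They form a
    pi-system generating the sigma-algebra of those columns. *)
Definition orthant S t := [set w | forall k, S k -> forall i, Y w i k <= t k i 0].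
Definition orthants S := [set A | exists t, A = orthant S t].

Lemma measurable_orthant S t : measurable (orthant S t).
Proof.
have -> : orthant S t = \bigcap_(ki in [set ki : 'I_m * 'I_p | S ki.1])
    ((fun w => Y w ki.2 ki.1) @^-1` `]-oo, t ki.1 ki.2 0]).
  apply/seteqP; split=> w /=.
    by move=> h [k i] /= Sk; rewrite in_itv /=; exact: h.
  by move=> h k Sk i; have := h (k, i) Sk; rewrite /= in_itv.
apply: fin_bigcap_measurable; first exact: finite_finset.
by move=> [k i] _; rewrite -[X in measurable X]setTI; apply: mY => //; exact: measurable_itv.
Qed.

Lemma orthants_measurable S : orthants S `<=` measurable.
Proof. by move=> _ [t ->]; exact: measurable_orthant. Qed.

Lemma orthants_setI S : setI_closed (orthants S).
Proof.
move=> _ _ [t ->] [t' ->].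
exists (fun k => \col_i Num.min (t k i 0) (t' k i 0)); apply/seteqP; split => w /=.
  by move=> [h h'] k Sk i; rewrite mxE le_min h ?h'.
move=> h; split => k Sk i; have := h k Sk i; rewrite mxE le_min => /andP[] //.
Qed.

(** An exhaustion of the space by orthants, required for uniqueness of measures on a pi-system. *)
Definition cube S n := orthant S (fun=> const_mx n%:R).

Lemma cube_orthants S n : orthants S (cube S n). Proof. by eexists. Qed.

Lemma cube_cover S : \bigcup_n cube S n = setT.
Proof.
apply/seteqP; split => // w _.
pose M := \sum_i \sum_k `|Y w i k|.
exists (Num.truncn M).+1 => // k _ i; rewrite mxE ltW // (le_lt_trans _ (truncnS_gt M)) //.
rewrite (le_trans (ler_norm _)) // /M (bigD1 i) //= (bigD1 k) //= -addrA lerDl.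
by rewrite addr_ge0 // ?sumr_ge0 // => l _; rewrite sumr_ge0.
Qed.

Lemma orthant_factor j t t' :
  P (orthant (predC1 j) t `&` orthant (pred1 j) t') =
  ((\prod_(k < m | k != j) P [set w | forall i, (col k (Y w) i ord0 <= t k i ord0)%R]) *
   P (orthant (pred1 j) t'))%E.
Proof.
have := indepY (fun k => if k == j then t' j else t k).
rewrite (bigD1 j) //= eqxx muleC => h.
have -> : orthant (predC1 j) t `&` orthant (pred1 j) t' = [set w | forall k i,
    (col k (Y w) i ord0 <= (if k == j then t' j else t k) i ord0)%R].
  apply/seteqP; split => w /=.
    move=> [h1 h2] k i; rewrite mxE; case: eqVneq => [->|kj]; first exact: h2 (eqxx _) _.
    exact: h1.
  move=> h1; split => k kj i; have := h1 k i; rewrite mxE; first by rewrite (negbTE kj).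
  by rewrite (eqP kj) eqxx.
rewrite h; congr (_ * _)%E; first by apply: eq_bigr => k /negbTE ->.
congr (P _); apply/seteqP; split => w /=.
  by move=> h1 k /eqP -> i; have := h1 i; rewrite mxE.
by move=> h1 i; rewrite mxE; exact: h1 (eqxx _) _.
Qed.

(** Two extensions from orthants to sigma-algebras: first for the event B of column j, with an
    orthant of the other columns fixed, then for A with B fixed. *)
Lemma column_indep j A B : <<s orthants (predC1 j) >> A -> <<s orthants (pred1 j) >> B ->
  P (A `&` B) = (P A * P B)%E.
Proof.
move=> sA sB.
have msub S C : <<s orthants S >> C -> measurable C.
  move=> sC; apply: (smallest_sub (@sigma_algebra_measurable _ T) _ sC).
  exact: orthants_measurable.
have step1 t : P (B `&` orthant (predC1 j) t) = (P B * P (orthant (predC1 j) t))%E.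
  rewrite setIC muleC.
  apply: (@pi_system_indep _ _ _ P _ _ _ (\prod_(k < m | k != j)
     P [set w | forall i, (col k (Y w) i ord0 <= t k i ord0)%R])%E
     (@orthants_measurable (pred1 j)) (@orthants_setI _) (cube_orthants _) (cube_cover _)) => //.
  - exact: measurable_orthant.
  - have pE k : [set w | forall i, (col k (Y w) i ord0 <= t k i ord0)%R] = orthant (pred1 k) t.
      apply/seteqP; split => w /=.
        by move=> h1 l /eqP -> i; have := h1 i; rewrite mxE.
      by move=> h1 i; rewrite mxE; exact: h1 (eqxx _) _.
    have /andP[-> pr1] : (0 <= \prod_(k < m | k != j)
        P [set w | forall i, (col k (Y w) i ord0 <= t k i ord0)%R] <= 1)%E.
      apply: (big_ind (fun x => (0 <= x <= 1)%E)); first by rewrite lexx lee01.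
        move=> x y /andP[x0 x1] /andP[y0 y1]; rewrite mule_ge0 //=.
        by rewrite -[leRHS]mule1 lee_pmul.
      by move=> k _; rewrite measure_ge0 pE probability_le1 //; exact: measurable_orthant.
    by rewrite (le_lt_trans pr1) // ltry.
  - by move=> _ [t' ->]; exact: orthant_factor.
rewrite setIC muleC.
apply: (@pi_system_indep _ _ _ P _ _ _ (P B) (@orthants_measurable (predC1 j)) (@orthants_setI _)
  (cube_orthants _) (cube_cover _)) => //.
- exact: msub sB.
- by rewrite measure_ge0 (le_lt_trans (probability_le1 _ _)) ?ltry //; exact: msub sB.
- by move=> _ [t ->]; exact: step1.
Qed.

(** A half-space for one entry is an increasing union of orthants whose remaining thresholds n tend
    to infinity. *)
Lemma measurable_entry S i k : S k ->
  measurable_fun (setT : set (g_sigma_algebraType (orthants S))) (fun w => Y w i k).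
Proof.
move=> Sk; apply: (measurability _ (RGenOInfty.measurableE R)) => _ [_ [x ->] <-].
rewrite setTI -[X in measurable X]setCK; apply: measurableC.
have -> : ~` ((fun w => Y w i k) @^-1` `]x, +oo[) = \bigcup_n
  orthant S (fun l => \col_a if (l == k) && (a == i) then x else n%:R).
  apply/seteqP; split => w /=.
    rewrite in_itv /= andbT => /negP; rewrite -leNgt => Yx.
    have : (\bigcup_n cube S n) w by rewrite cube_cover.
    move=> [n _ h]; exists n => // l Sl a; rewrite mxE.
    case: ifP => [/andP[/eqP -> /eqP ->] //|_].
    by have := h l Sl a; rewrite mxE.
  move=> [n _ h]; have := h k Sk i; rewrite mxE !eqxx /= in_itv /= andbT => h1.
  by apply/negP; rewrite -leNgt.
by apply: bigcup_measurable => n _; apply: sub_sigma_algebra; eexists.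
Qed.

Lemma measurable_id_orthants S :
  measurable_fun setT (fun w : T => w : g_sigma_algebraType (orthants S)).
Proof.
move=> _ A mA; rewrite setTI; have -> : (fun w : T => w) @^-1` A = A by [].
apply: (smallest_sub (@sigma_algebra_measurable _ T) _ mA).
exact: orthants_measurable.
Qed.

(* Tonelli for the law of (other columns, column [j]), which is a product. *)
Lemma column_tonelli j (h : T -> T -> \bar R) (K : R) :
  (forall w w', 0 <= h w w')%E ->
  measurable_fun setT (fun ww : g_sigma_algebraType (orthants (predC1 j)) *
    g_sigma_algebraType (orthants (pred1 j)) => h ww.1 ww.2) ->
  (forall w, \int[P]_w' h w w' <= K%:E)%E ->
  (\int[P]_w h w w <= K%:E)%E.
Proof.
move=> h0 mh hK.
(* Both factors are the sample space itself under a smaller sigma-algebra, and the random elements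
   are identity maps. The law of (w, w) is then the product of the two marginal laws by
   [column_indep]. *)
pose T1 := g_sigma_algebraType (orthants (predC1 j)).
pose T2 := g_sigma_algebraType (orthants (pred1 j)).
have m1 : measurable_fun setT (fun w : T => w : T1) by exact: measurable_id_orthants.
have m2 : measurable_fun setT (fun w : T => w : T2) by exact: measurable_id_orthants.
pose i1 : {mfun T >-> T1} := HB.pack (fun w : T => w : T1) (isMeasurableFun.Build _ _ _ _ _ m1).
pose i2 : {mfun T >-> T2} := HB.pack (fun w : T => w : T2) (isMeasurableFun.Build _ _ _ _ _ m2).
have m12 : measurable_fun setT (fun w : T => (w : T1, w : T2)) by exact: measurable_fun_pair.
pose i12 : {mfun T >-> (T1 * T2)%type} :=
  HB.pack (fun w : T => (w : T1, w : T2)) (isMeasurableFun.Build _ _ _ _ _ m12).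
pose f (ww : T1 * T2) := h ww.1 ww.2.
have prodE X : measurable X ->
    (distribution P i1 \x distribution P i2)%E X = distribution P i12 X.
  apply: product_measure_unique => A B mA mB.
  exact: (column_indep (j := j) mA mB).
have -> : (\int[P]_w h w w = \int[distribution P i12]_ww f ww)%E.
  by rewrite ge0_integral_distribution // => ww; exact: h0.
rewrite -(eq_measure_integral (distribution P i12) (fun A mA _ => prodE A mA)).
rewrite fubini_tonelli1 //; last by move=> ww; exact: h0.
apply: (@le_trans _ _ (\int[distribution P i1]_w cst K%:E w)%E); last first.
  have K1 x : x = 1%E -> (K%:E * x <= K%:E)%E by move=> ->; rewrite mule1.
  by rewrite integral_cst //; apply: K1; exact: (probability_setT P).
apply: ge0_le_integral => //.
- by move=> w _; apply: integral_ge0 => w' _; exact: h0.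
- by apply: measurable_fun_fubini_tonelli_F => // ww; exact: h0.
- move=> w _; rewrite /fubini_F (le_trans _ (hK w)) //.
  rewrite ge0_integral_distribution //; last by move=> w'; exact: h0.
  by apply: (measurableT_comp mh); exact: measurable_pair1.
Qed.

End Independence.

(** * Fluctuation moments *)

Section FluctuationMoments.
Context {R : realType} {d} {T : measurableType d} (P : probability T R).
Context {p : nat} (Psi : 'M[R]_p) (c1 c2 : R).
Hypotheses (symPsi : Psi^T = Psi) (c1_gt0 : 0 < c1) (c2_ge0 : 0 <= c2).
Hypothesis boundPsi : forall x, c1 * dot x x <= dot x (Psi *m x) <= c2 * dot x x.

Lemma coercivePsi x : c1 * dot x x <= dot x (Psi *m x).
Proof. by have /andP[] := boundPsi x. Qed.

Lemma posPsi x : x != 0 -> 0 < dot x (Psi *m x).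
Proof.
move=> x0; rewrite (lt_le_trans _ (coercivePsi x)) // mulr_gt0 //.
by rewrite lt_def dot_eq0 x0 dot_ge0.
Qed.

Lemma nrm_invPsi x : nrm (invmx Psi *m x) <= c1^-1 * nrm x.
Proof. exact: (coercive_nrm_invmx _ _ c1_gt0 coercivePsi). Qed.

Lemma trace_Psi_le : `|\tr Psi| <= c2 * p%:R.
Proof.
rewrite trace_dot (le_trans (ler_norm_sum _ _ _)) //.
rewrite -[p in p%:R](card_ord p) mulr_natr -sumr_const ler_sum // => i _.
have /andP[h1 h2] := boundPsi (delta_mx i 0); rewrite ger0_norm.
  by rewrite (le_trans h2) // -sqr_nrm nrm_delta expr1n mulr1.
by rewrite (le_trans _ h1) // mulr_ge0 ?dot_ge0 // ltW.
Qed.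

Lemma mvnormal_measurable (X : T -> 'cV[R]_p) i : has_mvnormal0_law P X Psi ->
  measurable_fun setT (fun w => X w i 0).
Proof.
move=> lawX; have e0 : (delta_mx i 0 : 'cV[R]_p) != 0.
  apply/eqP => e0; have := nrm_delta (R := R) i; rewrite e0 /nrm dot0l sqrtr0.
  by move/eqP; rewrite eq_sym oner_eq0.
have [mX _] := lawX _ e0; have -> : (fun w => X w i 0) = (fun w => dot (delta_mx i 0) (X w)).
  by apply/funext => w; rewrite dot_delta.
exact: mX.
Qed.

Lemma quad_fourth_moment (X : T -> 'cV[R]_p) (A : 'M[R]_p) (g : R) :
  has_mvnormal0_law P X Psi -> 0 <= g ->
  (forall y, `|dot (A *m y) (Psi *m (A *m y)) + dot (A^T *m y) (Psi *m (A *m y))|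
     <= g * dot y y) ->
  (\int[P]_w ((dot (X w) (A *m X w) - \tr (A *m Psi)) ^+ 4)%:E
     <= (27 * (g * c2 * p%:R) ^+ 2)%:E)%E.
Proof.
move=> lawX g0 Ag.
have mF : all_moments P (fun w => (dot (X w) (A *m X w) - \tr (A *m Psi)) ^+ 4).
  by apply: all_momentsX; apply: (all_moments_quad posPsi lawX).
have iF := all_moments_integrable _ _ mF.
rewrite -[leLHS](fineK (integrable_fin_num measurableT iF)) lee_fin.
rewrite (le_trans (fourth_moment_le symPsi posPsi lawX A g g0 Ag)) //.
have h := sqnorm_moment_le posPsi lawX c2 (fun y => (andP (boundPsi y)).2) c2_ge0.
have -> : 27 * (g * c2 * p%:R) ^+ 2 = 9 * g ^+ 2 * (3 * (c2 * p%:R) ^+ 2) by ring.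
by rewrite ler_wpM2l // mulr_ge0 // sqr_ge0.
Qed.

Section Matrix.
Context {m : nat} (Y : T -> 'M[R]_(p, m)).
Hypothesis iidY : iid_mvnormal0_columns P Y Psi.

Lemma measurable_iid : measurable_mx Y.
Proof.
move=> i j; have := mvnormal_measurable i (iidY.2 j).
by under eq_fun do rewrite mxE.
Qed.

Lemma measurable_mx_col {d'} {T' : measurableType d'} (Z : T' -> 'M[R]_(p, m)) j :
  (forall i, measurable_fun setT (fun w => Z w i j)) -> measurable_mx (fun w => col j (Z w)).
Proof. by move=> mZ i k; under eq_fun do rewrite mxE; exact: mZ. Qed.

Lemma measurable_mx_Vmat_drop {d'} {T' : measurableType d'} (Z : T' -> 'M[R]_(p, m)) j a :
  0 < a -> (forall i k, k != j -> measurable_fun setT (fun w => Z w i k)) ->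
  measurable_mx (fun w => Vmat (gram_drop (Z w) j) a).
Proof.
move=> a0 mZ; apply: measurable_invmx; last first.
  by move=> w; apply: (Vmat_unit (psd_gram_drop _ _) a0).
apply: measurable_mxD; last exact: measurable_mx_cst.
apply: measurable_mx_sum => k kj.
by apply: measurable_mxM; last apply: measurable_mx_tr;
  apply: measurable_mx_col => i; exact: mZ.
Qed.

Lemma measurable_fluctuation_pair {d'} {T' : measurableType d'} (y : T' -> 'cV[R]_p)
    (V : T' -> 'M[R]_p) : measurable_mx y -> measurable_mx V ->
  measurable_fun setT (fun w => ((dot (y w) (invmx Psi *m V w *m y w) - \tr (V w)) ^+ 4)%:E).
Proof.
move=> my mV; apply/measurable_EFinP/measurable_funX/measurable_funB.
  apply: (measurable_mxM (measurable_mx_tr my)); apply: measurable_mxM => //.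
  by apply: measurable_mxM => //; exact: measurable_mx_cst.
exact: measurable_trace.
Qed.

Lemma measurable_fluctuation a j : 0 < a ->
  measurable_fun setT (fun w => (fluctuation (Y w) (invmx Psi) a j ^+ 4)%:E).
Proof.
move=> a0; apply: measurable_fluctuation_pair.
  by apply: measurable_mx_col => i; exact: measurable_iid.
by apply: measurable_mx_Vmat_drop => // i k _; exact: measurable_iid.
Qed.

(** With the other columns frozen, A = Psi^-1 V_j satisfies Psi A = V_j, so the centring tr(A Psi)
    is tr V_j and the form G is at most 2 |y|^2 / (c1 a^2). For a of order n and p = O(n) the bound
    is O(n^-2). *)
Lemma fluctuation_fourth_moment a j : 0 < a ->
  (\int[P]_w (fluctuation (Y w) (invmx Psi) a j ^+ 4)%:E <=
     (27 * (2 / (c1 * a ^+ 2) * c2 * p%:R) ^+ 2)%:E)%E.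
Proof.
move=> a0; set B := invmx Psi.
have BPsi : B *m Psi = 1%:M by rewrite mulVmx // (coercive_unitmx _ _ c1_gt0 coercivePsi).
have PsiB : Psi *m B = 1%:M by rewrite mulmxV // (coercive_unitmx _ _ c1_gt0 coercivePsi).
have BT : B^T = B by rewrite /B trmx_inv symPsi.
pose V w := Vmat (gram_drop (Y w) j) a.
pose h w w' := ((dot (col j (Y w')) (B *m V w *m col j (Y w')) - \tr (V w)) ^+ 4)%:E.
apply: (@column_tonelli _ _ _ P _ _ Y measurable_iid iidY.1 j h).
- by move=> w w'; rewrite lee_fin exprn_even_ge0.
- pose T12 := (g_sigma_algebraType (orthants Y (predC1 j)) *
    g_sigma_algebraType (orthants Y (pred1 j)))%type.
  apply: (@measurable_fluctuation_pair _ T12 (fun ww => col j (Y ww.2)) (fun ww => V ww.1)).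
    move=> i k; apply: (measurable_mx_comp (T := g_sigma_algebraType (orthants Y (pred1 j)))
      (M := fun w => col j (Y w))) => //.
    by apply: measurable_mx_col => l; apply: measurable_entry => //=.
  move=> i k; apply: (measurable_mx_comp (T := g_sigma_algebraType (orthants Y (predC1 j))) (M := V)) => //.
  by apply: measurable_mx_Vmat_drop => // l l' ll'; exact: measurable_entry.
move=> w; have psdj := psd_gram_drop (Y w) j.
rewrite /h; have -> : \tr (V w) = \tr (B *m V w *m Psi) by rewrite mxtrace_mulC mulmxA PsiB mul1mx.
apply: (@quad_fourth_moment _ (B *m V w) (2 / (c1 * a ^+ 2)) (iidY.2 j)).
  by rewrite divr_ge0 // mulr_ge0 ?sqr_ge0 // ltW.
move=> y; rewrite trmx_mul BT tr_Vmat // -!mulmxA (mulmxA Psi) PsiB mul1mx.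
have n0 (x : 'cV[R]_p) := nrm_ge0 x.
have V1 x : nrm (V w *m x) <= a^-1 * nrm x by exact: nrm_Vmat psdj a0 x.
have ca : 0 <= c1^-1 by rewrite invr_ge0 ltW.
have aa : 0 <= a^-1 by rewrite invr_ge0 ltW.
rewrite (le_trans (ler_normD _ _)) //.
have -> : 2 / (c1 * a ^+ 2) * dot y y = (c1^-1 * (a^-1 * nrm y)) * (a^-1 * nrm y) +
   (a^-1 * (c1^-1 * nrm y)) * (a^-1 * nrm y).
  by rewrite -sqr_nrm; field; rewrite !gt_eqF.
apply: lerD; rewrite (le_trans (dot_le_nrm _ _)) // ler_pM //.
  by rewrite (le_trans (nrm_invPsi _)) // ler_wpM2l.
by rewrite (le_trans (V1 _)) // ler_wpM2l // nrm_invPsi.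
Qed.

Lemma measurable_sqnorm j :
  measurable_fun setT (fun w => ((nrm (col j (Y w)) ^+ 2 - \tr Psi) ^+ 4)%:E).
Proof.
apply/measurable_EFinP/measurable_funX/measurable_funB => //.
under eq_fun do rewrite sqr_nrm.
have mc : measurable_mx (fun w => col j (Y w)).
  by apply: measurable_mx_col => i; exact: measurable_iid.
exact: (measurable_mxM (measurable_mx_tr mc) mc).
Qed.

Lemma sqnorm_fourth_moment j :
  (\int[P]_w ((nrm (col j (Y w)) ^+ 2 - \tr Psi) ^+ 4)%:E <=
     (27 * (2 * c2 * c2 * p%:R) ^+ 2)%:E)%E.
Proof.
rewrite (eq_integral (fun w => ((dot (col j (Y w)) (1%:M *m col j (Y w)) -
  \tr (1%:M *m Psi)) ^+ 4)%:E)); last by move=> w _; rewrite !mul1mx sqr_nrm.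
apply: (@quad_fourth_moment _ 1%:M (2 * c2) (iidY.2 j)); first by rewrite mulr_ge0.
move=> y; rewrite trmx1 !mul1mx; have /andP[h1 h2] := boundPsi y.
rewrite ger0_norm; first by lra.
have : 0 <= dot y (Psi *m y) by rewrite (le_trans _ h1) // mulr_ge0 ?dot_ge0 // ltW.
lra.
Qed.

End Matrix.
End FluctuationMoments.

(** * Almost sure convergence from summable expectations *)

Section AlmostSure.
Context {R : realType} {d} {T : measurableType d} (P : probability T R).

(** The expectations are summed by 1/k^2 <= 1/(k - 1) - 1/k. The series of the U n thus has finite
    expectation, is finite almost surely, and its terms tend to 0. *)
Lemma ae_cvg0 (U : nat -> T -> R) (K : R) (N : nat) : 0 <= K ->
  (forall n, measurable_fun setT (U n)) -> (forall n w, 0 <= U n w) ->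
  (forall n, (N <= n)%N -> \int[P]_w (U n w)%:E <= (K / n%:R ^+ 2)%:E)%E ->
  {ae P, forall w, (fun n => U n w) @ \oo --> 0}.
Proof.
move=> K0 mU U0 EU.
(* This offset starts the series where the moment bound holds and keeps [(n + M).-1] positive. *)
pose M := N.+2; pose U' n w := (U (n + M)%N w)%:E.
have mU' n : measurable_fun setT (U' n) by apply/measurable_EFinP; exact: mU.
have U'0 n w : (0 <= U' n w)%E by rewrite lee_fin.
pose S w := (\sum_(0 <= n <oo) U' n w)%E.
have telescope n : (\sum_(0 <= k < n) \int[P]_w U' k w <= (K * (1 - (n + M).-1%:R^-1))%:E)%E.
  elim: n => [|n IHn].
    by rewrite big_geq // lee_fin mulr_ge0 // subr_ge0 invf_le1 ?ler1n // ltr0n.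
  have NM : (N <= n + M)%N by rewrite /M; lia.
  rewrite big_nat_recr //= (le_trans (leeD IHn (EU _ NM))) //.
  rewrite -EFinD lee_fin -mulrDr ler_wpM2l //.
  have -> : (n + M)%:R = (n + M).-1%:R + 1 :> R by rewrite natr1 /M addnS.
  have : 0 < (n + M).-1%:R :> R by rewrite ltr0n /M; lia.
  move: (_%:R) => x x0; rewrite -subr_ge0.
  have -> : 1 - (x + 1)^-1 - (1 - x^-1 + (x + 1) ^- 2) = ((x + 1) ^+ 2 * x)^-1.
    by field; rewrite !gt_eqF // addr_gt0.
  by rewrite invr_ge0 mulr_ge0 ?sqr_ge0 // ltW.
have ES : (\int[P]_w S w < +oo)%E.
  rewrite /S integral_nneseries //.
  apply: (@le_lt_trans _ _ K%:E); last by rewrite ltry.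
  apply: lime_le; first by apply: is_cvg_nneseries => n _ _; exact: integral_ge0.
  apply: nearW => n; rewrite (le_trans (telescope n)) // lee_fin.
  by rewrite ler_piMr // lerBlDr lerDl invr_ge0.
have mS : measurable_fun setT S by apply: ge0_emeasurable_sum.
have S0 w : (0 <= S w)%E by exact: nneseries_ge0.
have iS : P.-integrable setT S.
  apply/integrableP; split => //.
  by under eq_integral do rewrite gee0_abs //.
apply: filterS (integrable_ae measurableT iS) => w /(_ I) Sfin.
rewrite -(cvg_shiftn M).
apply: cvg_series_cvg_0; apply: nondecreasing_is_cvgn.
  by apply/nondecreasing_seqP => n; rewrite /series /= big_nat_recr //= lerDl.
exists (fine (S w)) => _ [n _ <-]; rewrite -lee_fin fineK // /series /= -sumEFin.
by apply: (nneseries_lim_ge (u_ := fun k => U' k w)) => *; exact: U'0.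
Qed.

End AlmostSure.

(** * Pathwise bounds *)

(** Turns smallness of fourth powers into smallness of absolute values, with a threshold e chosen by
    the user. *)
Lemma norm_le_fourth_power {R : realFieldType} (e x : R) : 0 < e -> `|x| <= e + x ^+ 4 / e ^+ 3.
Proof.
move=> e0; have e3 : 0 < e ^+ 3 by rewrite exprn_gt0.
have x4 : 0 <= x ^+ 4 by rewrite exprn_even_ge0.
have [xe|ex] := leP `|x| e; first by rewrite (le_trans xe) // lerDl divr_ge0 // ltW.
rewrite -(ger0_norm x4) normrX.
apply: (@le_trans _ _ (`|x| ^+ 4 / e ^+ 3)); last by rewrite lerDr ltW.
rewrite ler_pdivlMr // (exprS `|x|).
by rewrite ler_wpM2l // lerXn2r ?nnegrE // ltW.
Qed.

Section Pathwise.
Context {R : realType} {n p : nat} (Y : 'M[R]_(p, n.-1)) (Psi B : 'M[R]_p).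
Context (k c2 C alpha : R).
Hypotheses (n_gt0 : (0 < n)%N) (k_ge0 : 0 <= k) (c2_ge0 : 0 <= c2) (C_gt0 : 0 < C).
Hypotheses (alpha_gt0 : 0 < alpha) (p_le : p%:R <= C * n%:R).
Hypothesis nrm_B : forall x, nrm (B *m x) <= k * nrm x.
Hypothesis tr_Psi : `|\tr Psi| <= c2 * p%:R.
Let a0 := alpha * n%:R.
Let N0 : 0 < n%:R :> R. Proof. by rewrite ltr0n. Qed.
Let a0_gt0 : 0 < a0. Proof. by rewrite mulr_gt0. Qed.
Let m_le : n.-1%:R <= n%:R :> R. Proof. by rewrite ler_nat leq_pred. Qed.

(* The weights make both sums of expectation O(n^-2). *)
Definition fourth_powers : R :=
  (\sum_j fluctuation Y B a0 j ^+ 4) / n%:R +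
  (\sum_j (nrm (col j Y) ^+ 2 - \tr Psi) ^+ 4) / n%:R ^+ 5.

Let sumF_ge0 : 0 <= \sum_j fluctuation Y B a0 j ^+ 4.
Proof. by apply: sumr_ge0 => j _; rewrite exprn_even_ge0. Qed.

Let sumH_ge0 : 0 <= \sum_j (nrm (col j Y) ^+ 2 - \tr Psi) ^+ 4.
Proof. by apply: sumr_ge0 => j _; rewrite exprn_even_ge0. Qed.

Lemma discrepancy_le_fourth_powers e : 0 < e ->
  `|discrepancy Y B a0| <= alpha^-1 + n%:R * (e + fourth_powers / e ^+ 3).
Proof.
move=> e0; rewrite (le_trans (discrepancy_le Y B a0 a0_gt0)) // lerD //.
  rewrite ler_pdivrMr // /a0 mulrA mulVf ?mul1r ?gt_eqF //.
apply: (@le_trans _ _ (\sum_(j < n.-1) (e + fluctuation Y B a0 j ^+ 4 / e ^+ 3))).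
  by apply: ler_sum => j _; exact: norm_le_fourth_power.
rewrite big_split /= sumr_const card_ord -mulr_suml -[_ *+ n.-1]mulr_natl mulrDr lerD //.
  by rewrite ler_wpM2r // ltW.
rewrite mulrA ler_wpM2r ?invr_ge0 ?exprn_ge0 ?(ltW e0) //.
rewrite /fourth_powers mulrDr mulrCA divff ?gt_eqF // mulr1 lerDl.
by rewrite mulr_ge0 ?(ltW N0) // divr_ge0 // exprn_ge0 // ltW.
Qed.

Lemma trace_gram_le : \tr (gram Y) <= n%:R ^+ 2 * (c2 * C + 1 + fourth_powers).
Proof.
rewrite trace_gram.
apply: (@le_trans _ _ (\sum_(j < n.-1) (c2 * (C * n%:R) + n%:R +
    (nrm (col j Y) ^+ 2 - \tr Psi) ^+ 4 / n%:R ^+ 3))).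
  apply: ler_sum => j _.
  (* The threshold is n: an error of order n per column is affordable, since the trace itself is of
     order n^2. *)
  have h := norm_le_fourth_power _ (nrm (col j Y) ^+ 2 - \tr Psi) N0.
  have h2 := ler_norm (nrm (col j Y) ^+ 2 - \tr Psi).
  have h3 := ler_norm (\tr Psi).
  have h4 : c2 * p%:R <= c2 * (C * n%:R) by rewrite ler_wpM2l.
  move: h h2 h3 h4 tr_Psi; set z := _ / n%:R ^+ 3; lra.
rewrite big_split /= sumr_const card_ord -mulr_suml -[_ *+ n.-1]mulr_natl.
have -> : n%:R ^+ 2 * (c2 * C + 1 + fourth_powers) =
   n%:R * (c2 * (C * n%:R) + n%:R) + n%:R ^+ 2 * fourth_powers by ring.
apply: lerD.
  by rewrite ler_wpM2r // addr_ge0 ?(ltW N0) // !mulr_ge0 // ltW.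
rewrite /fourth_powers mulrDr.
have -> : n%:R ^+ 2 * ((\sum_j (nrm (col j Y) ^+ 2 - \tr Psi) ^+ 4) / n%:R ^+ 5) =
   (\sum_j (nrm (col j Y) ^+ 2 - \tr Psi) ^+ 4) / n%:R ^+ 3.
  by field; rewrite gt_eqF.
by rewrite lerDr mulr_ge0 ?exprn_ge0 ?(ltW N0) // divr_ge0 // ltW.
Qed.

Section Perturbation.
Variables (a tau : R).
Hypotheses (a_ge : a0 / 2 <= a) (tau_ge : \tr (gram Y) <= n%:R ^+ 2 * tau).
Let a_gt0 : 0 < a. Proof. by rewrite (lt_le_trans _ a_ge) // divr_gt0. Qed.
Let V := Vmat (gram Y) a.
Let V0 := Vmat (gram Y) a0.

Let tb := 2 * C / alpha.

Lemma trace_Vmat_bound : `|\tr V| <= tb.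
Proof.
rewrite (le_trans (trace_Vmat_le Y a a_gt0)) // ler_pdivrMr //.
rewrite (le_trans p_le) // (@le_trans _ _ (tb * (a0 / 2))) //.
  by rewrite le_eqVlt /tb /a0; apply/orP; left; apply/eqP; field; rewrite gt_eqF.
by rewrite ler_wpM2l // /tb divr_ge0 ?ltW // mulr_gt0.
Qed.

Lemma trace_Vmat0_bound : `|\tr V0| <= C / alpha.
Proof.
rewrite (le_trans (trace_Vmat_le Y a0 a0_gt0)) // ler_pdivrMr // (le_trans p_le) //.
by rewrite /a0 mulrA divfK ?gt_eqF.
Qed.

Lemma aa0_ge : (alpha * n%:R) ^+ 2 / 2 <= a * a0.
Proof. by rewrite expr2 mulrAC ler_wpM2r ?(ltW a0_gt0). Qed.

(** Here [tau] bounds [\tr gram / n^2]. The coefficient collects 2C(1 + C) from the change of [tr V]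
    against m - p, 4C^2 + 6C^2 from the two parts of the change of a (tr V)^2, and 2 k tau from the
    term with B. *)
Lemma discrepancy_perturb :
  `|discrepancy Y B a - discrepancy Y B a0| <=
  `|a - a0| * ((2 * C * (1 + C) + 10 * C ^+ 2 + 2 * k * tau) / alpha ^+ 2).
Proof.
have aa0 : 0 < a * a0 by rewrite mulr_gt0.
have h1 : `|\tr V - \tr V0| <= `|a - a0| * (2 * C / (alpha ^+ 2 * n%:R)).
  rewrite (le_trans (trace_Vmat_perturb Y a a0 a_gt0 a0_gt0)) // -mulrA ler_wpM2l //.
  rewrite ler_pdivrMr // (le_trans p_le) //.
  apply: (@le_trans _ _ (2 * C / (alpha ^+ 2 * n%:R) * ((alpha * n%:R) ^+ 2 / 2))).
    by rewrite le_eqVlt; apply/orP; left; apply/eqP; field; rewrite !gt_eqF.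
  by rewrite ler_wpM2l ?aa0_ge // divr_ge0 ?mulr_ge0 ?(ltW C_gt0) ?(ltW N0) ?(ltW alpha_gt0).
have tau0 : 0 <= tau.
  by have := le_trans (trace_gram_ge0 Y) tau_ge; rewrite pmulr_rge0 // exprn_gt0.
have h2 := trace_Vmat_B_perturb Y B k k_ge0 nrm_B a a0 a_gt0 a0_gt0.
have {}h2 : `|\tr B - a * \tr (V *m B) - (\tr B - a0 * \tr (V0 *m B))| <=
    `|a - a0| * (2 * k * tau / alpha ^+ 2).
  rewrite (le_trans h2) //.
  have -> : `|a - a0| * k * \tr (gram Y) / (a * a0) =
    `|a - a0| * (k * \tr (gram Y) / (a * a0)) by rewrite !mulrA.
  have -> : 2 * k * tau / alpha ^+ 2 = 2 * (k * (tau / alpha ^+ 2)) by rewrite !mulrA.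
  rewrite ler_wpM2l // ler_pdivrMr //.
  apply: (@le_trans _ _ (k * (n%:R ^+ 2 * tau))); first by rewrite ler_wpM2l.
  apply: (@le_trans _ _ (2 * (k * (tau / alpha ^+ 2)) * ((alpha * n%:R) ^+ 2 / 2))).
    by rewrite le_eqVlt; apply/orP; left; apply/eqP; field; rewrite !gt_eqF.
  by rewrite ler_wpM2l ?aa0_ge // !mulr_ge0 // invr_ge0 exprn_ge0 // ltW.
have mp : `|n.-1%:R - p%:R : R| <= (1 + C) * n%:R.
  rewrite (le_trans (ler_normB _ _)) // !ger0_norm // mulrDl mul1r lerD //.
rewrite /discrepancy -/V -/V0.
set t := \tr V in h1 *; set t0 := \tr V0 in h1 *.
set q := \tr B - _ in h2 *; set q0 := \tr B - _ in h2 *.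
have -> : t * (n.-1%:R - p%:R + a * t) - q - (t0 * (n.-1%:R - p%:R + a0 * t0) - q0) =
   (t - t0) * (n.-1%:R - p%:R) + (a - a0) * t ^+ 2 + a0 * ((t - t0) * (t + t0)) - (q - q0).
  by ring.
have tB : `|t| <= tb by exact: trace_Vmat_bound.
have t0B : `|t0| <= C / alpha by exact: trace_Vmat0_bound.
have tb0 : 0 <= tb by rewrite (le_trans _ tB).
have s1 : `|(t - t0) * (n.-1%:R - p%:R)| <=
    `|a - a0| * (2 * C / (alpha ^+ 2 * n%:R)) * ((1 + C) * n%:R).
  by rewrite normrM ler_pM.
have s2 : `|(a - a0) * t ^+ 2| <= `|a - a0| * tb ^+ 2.
  by rewrite normrM normrX ler_wpM2l // lerXn2r ?nnegrE.
have s3 : `|a0 * ((t - t0) * (t + t0))| <=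
    a0 * (`|a - a0| * (2 * C / (alpha ^+ 2 * n%:R)) * (tb + C / alpha)).
  rewrite normrM (gtr0_norm a0_gt0) ler_wpM2l ?(ltW a0_gt0) // normrM ler_pM //.
  by rewrite (le_trans (ler_normD _ _)) // lerD.
rewrite (le_trans (ler_normB _ _)) // (le_trans (lerD (ler_normD _ _) (lexx _))) //.
rewrite (le_trans (lerD (lerD (ler_normD _ _) (lexx _)) (lexx _))) //.
rewrite (le_trans (lerD (lerD (lerD s1 s2) s3) h2)) //.
rewrite le_eqVlt /tb /a0; apply/orP; left; apply/eqP; field; by rewrite !gt_eqF.
Qed.

(** The contradiction of the overview made quantitative. Here [ts] bounds tr V from below, and [eta]
    is chosen so that (k + tb) eta tau = ts / 4. Of the lower bound ts n / 2 for (n - 1) tr V, the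
    discrepancy and the eta terms take ts n / 8 each; the remaining ts n / 4 must come from tr(V^2
    W). *)
Lemma trace_sqr_lower_bound C0 :
  0 < C0 -> C0 * n%:R <= p%:R -> a <= 2 * a0 -> (1 < n)%N -> 0 < tau ->
  let ts := C0 / (tau + 2 * alpha * C) * C0 in
  let eta := ts / (4 * (k + tb) * tau) in
  `|discrepancy Y B a| <= n%:R * (ts / 8) ->
  eta * ts / (2 * (k + tb)) <= \tr (V *m V *m gram Y).
Proof.
move=> C0_gt0 p_ge a_le n1 tau0 ts eta.
have tb0 : 0 < tb by rewrite divr_gt0 // mulr_gt0.
have den0 : 0 < tau + 2 * alpha * C by rewrite addr_gt0 // !mulr_gt0.
have ktb : 0 < k + tb by rewrite ltr_wpDl.
have ts0 : 0 < ts by rewrite mulr_gt0 // divr_gt0.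
have eta0 : 0 < eta by rewrite divr_gt0 // !mulr_gt0.
(* The maximizer of 2 s C0 n - s^2 n^2 (tau + 2 alpha C), a lower bound for tr V whose maximum is
   [ts]. *)
pose s := C0 / (tau + 2 * alpha * C) / n%:R.
have t_ge : ts <= \tr V.
  have := trace_Vmat_ge Y a s a_gt0; rewrite -/V; apply: le_trans.
  have s0 : 0 < s by rewrite !divr_gt0.
  have : s ^+ 2 * (\tr (gram Y) + a * p%:R) <=
     s ^+ 2 * (n%:R ^+ 2 * tau + 2 * (alpha * n%:R) * (C * n%:R)).
    rewrite ler_wpM2l ?sqr_ge0 // lerD //; apply: ler_pM => //; exact: ltW.
  have -> : s ^+ 2 * (n%:R ^+ 2 * tau + 2 * (alpha * n%:R) * (C * n%:R)) = ts.
    by rewrite /s /ts; field; rewrite !gt_eqF.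
  have : s * (C0 * n%:R) <= s * p%:R by rewrite ler_wpM2l // ltW.
  have -> : s * (C0 * n%:R) = ts by rewrite /s /ts; field; rewrite !gt_eqF.
  lra.
set S := \tr (V *m V *m gram Y); set q := \tr B - a * \tr (V *m B).
pose x := \tr (V *m gram Y).
have D_eq : \tr V * n.-1%:R = discrepancy Y B a + q + \tr V * x.
  by rewrite /x /V trace_Vmat_gram // /discrepancy -/V /q; ring.
have e0 : 0 < eta / n%:R by rewrite divr_gt0.
have Sx : 2 * x <= eta * tau * n%:R + S * n%:R / eta.
  have := sqr_trace_ineq Y a (eta / n%:R); rewrite -/V -/S -/x => h.
  rewrite -(ler_pM2l e0); have -> : eta / n%:R * (2 * x) = 2 * (eta / n%:R) * x by ring.
  rewrite (le_trans h) //.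
  have -> : eta / n%:R * (eta * tau * n%:R + S * n%:R / eta) =
     S + (eta / n%:R) ^+ 2 * (n%:R ^+ 2 * tau) by field; rewrite !gt_eqF.
  by rewrite lerD2l ler_wpM2l ?sqr_ge0.
have Sq : 2 * q <= k * (eta * tau * n%:R + S * n%:R / eta).
  rewrite (le_trans (trace_B_ineq Y B k k_ge0 nrm_B a _ a_gt0 e0)) // ler_wpM2l //.
  rewrite -/V -/S invf_div mulrA lerD2r.
  rewrite (le_trans (ler_wpM2l (ltW e0) tau_ge)) //.
  by rewrite le_eqVlt; apply/orP; left; apply/eqP; field; rewrite !gt_eqF.
have m_ge : n%:R / 2 <= n.-1%:R :> R.
  have : 2 <= n%:R :> R by rewrite ler_nat.
  have : n%:R = n.-1%:R + 1 :> R by rewrite natr1 prednK.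
  lra.
move=> Dn; have := le_trans (ler_norm _) Dn => Dn'.
have E1 : ts * (n%:R / 2) <= \tr V * n.-1%:R.
  by apply: ler_pM => //; exact: ltW.
have tVb : \tr V <= tb by exact: le_trans (ler_norm _) trace_Vmat_bound.
have S0 : 0 <= S by exact: trace_sqr_gram_ge0.
have X0 : 0 <= eta * tau * n%:R + S * n%:R / eta.
  apply: addr_ge0; first exact: (mulr_ge0 (mulr_ge0 (ltW eta0) (ltW tau0)) (ltW N0)).
  exact: (divr_ge0 (mulr_ge0 S0 (ltW N0)) (ltW eta0)).
have E2 : 2 * (\tr V * x) <= tb * (eta * tau * n%:R + S * n%:R / eta).
  rewrite mulrCA (le_trans (ler_wpM2l _ Sx)) ?(le_trans (ltW ts0) t_ge) //.
  by rewrite ler_wpM2r.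
have E3 : (k + tb) * (eta * tau * n%:R) = ts / 4 * n%:R.
  by rewrite /eta; field; rewrite !gt_eqF.
have E4 : ts / 2 * n%:R <= (k + tb) * (S * n%:R / eta).
  have gen (A A' q' u D' N' t' k' b' : R) : 2 * q' <= k' * (A + A') ->
      2 * u <= b' * (A + A') -> t' * (N' / 2) <= D' + q' + u -> D' <= N' * (t' / 8) ->
      (k' + b') * A = t' / 4 * N' -> t' / 2 * N' <= (k' + b') * A' by lra.
  by move: E1; rewrite D_eq => E1; exact: gen Sq E2 E1 Dn' E3.
have {}E4 : ts / 2 <= (k + tb) * S / eta.
  rewrite -(ler_pM2r N0) (le_trans E4) // le_eqVlt; apply/orP; left; apply/eqP.
  by field; rewrite gt_eqF.
move: E4; rewrite ler_pdivlMr // => E4.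
rewrite ler_pdivrMr ?mulr_gt0 //; lra.
Qed.

End Perturbation.
End Pathwise.

(** * Expectation of the fourth powers, and reduction of the difference to the discrepancy *)

Section Assembly.
Context {R : realType} {d} {T : measurableType d} (P : probability T R).

Lemma measurable_fourth_powers {n p : nat} (Psi : 'M[R]_p) (Y : T -> 'M[R]_(p, n.-1))
    (c1 c2 alpha : R) : 0 < c1 ->
  (forall x, c1 * dot x x <= dot x (Psi *m x) <= c2 * dot x x) ->
  iid_mvnormal0_columns P Y Psi -> 0 < alpha ->
  measurable_fun setT (fun w => fourth_powers (Y w) Psi (invmx Psi) alpha).
Proof.
move=> c1_gt0 bPsi iidY alpha0.
apply: measurable_funD; apply: measurable_funM => //; apply: measurable_sum => j.
  (* The index j in ['I_n.-1] excludes n = 0. *)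
  have n0 : 0 < n%:R :> R by rewrite ltr0n; case: (n) (j) => [[]|].
  by apply/measurable_EFinP; apply: (measurable_fluctuation iidY); rewrite mulr_gt0.
by apply/measurable_EFinP; exact: (measurable_sqnorm iidY).
Qed.

(** The fluctuations contribute an average of at most n terms of size O(n^-2), the squared norms at
    most n terms of size O(n^2) divided by n^5. *)
Lemma exp_fourth_powers {n p : nat} (Psi : 'M[R]_p) (Y : T -> 'M[R]_(p, n.-1))
    (c1 c2 alpha C : R) : Psi^T = Psi -> 0 < c1 -> 0 <= c2 ->
  (forall x, c1 * dot x x <= dot x (Psi *m x) <= c2 * dot x x) ->
  iid_mvnormal0_columns P Y Psi -> 0 < alpha -> 0 < C -> (0 < n)%N ->
  p%:R <= C * n%:R ->
  (\int[P]_w (fourth_powers (Y w) Psi (invmx Psi) alpha)%:E <=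
    ((27 * (2 / (c1 * alpha ^+ 2) * c2 * C) ^+ 2 + 27 * (2 * c2 * c2 * C) ^+ 2) / n%:R ^+ 2)%:E)%E.
Proof.
move=> symPsi c1_gt0 c2_ge0 bPsi iidY alpha0 C0 n0 pC.
have N0 : 0 < n%:R :> R by rewrite ltr0n.
have a0 : 0 < alpha * n%:R by rewrite mulr_gt0.
have mn : n.-1%:R <= n%:R :> R by rewrite ler_nat leq_pred.
pose F w j := fluctuation (Y w) (invmx Psi) (alpha * n%:R) j ^+ 4.
pose H w j := (nrm (col j (Y w)) ^+ 2 - \tr Psi) ^+ 4.
have F0 w j : 0 <= F w j by rewrite exprn_even_ge0.
have H0 w j : 0 <= H w j by rewrite exprn_even_ge0.
have mF j : measurable_fun setT (fun w => (F w j)%:E) by exact: (measurable_fluctuation iidY).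
have mH j : measurable_fun setT (fun w => (H w j)%:E) by exact: (measurable_sqnorm iidY).
pose KF := 27 * (2 / (c1 * (alpha * n%:R) ^+ 2) * c2 * p%:R) ^+ 2.
pose KH := 27 * (2 * c2 * c2 * p%:R) ^+ 2.
have intF j : (\int[P]_w (F w j)%:E <= KF%:E)%E.
  have h := @fluctuation_fourth_moment R d T P p Psi c1 c2 symPsi c1_gt0 c2_ge0 bPsi _ Y iidY.
  exact: h.
have intH j : (\int[P]_w (H w j)%:E <= KH%:E)%E.
  have h := @sqnorm_fourth_moment R d T P p Psi c1 c2 symPsi c1_gt0 c2_ge0 bPsi _ Y iidY.
  exact: h.
have intS (G : T -> 'I_n.-1 -> R) (K s : R) : 0 <= s -> 0 <= K -> (forall w j, 0 <= G w j) ->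
    (forall j, measurable_fun setT (fun w => (G w j)%:E)) ->
    (forall j, \int[P]_w (G w j)%:E <= K%:E)%E ->
    (\int[P]_w ((\sum_j G w j) * s)%:E <= (n%:R * K * s)%:E)%E.
  move=> s0 K0 G0 mG GK.
  under eq_integral do rewrite EFinM -sumEFin muleC.
  rewrite ge0_integralZl //; last 2 first.
  - exact: emeasurable_sum.
  - by move=> w _; apply: sume_ge0 => j _; rewrite lee_fin.
  rewrite ge0_integral_sum //; last by move=> j w _; rewrite lee_fin.
  rewrite [leRHS]EFinM muleC lee_pmul //.
    by apply: sume_ge0 => j _; apply: integral_ge0 => w _; rewrite lee_fin.
  apply: (@le_trans _ _ (\sum_(j < n.-1) K%:E)%E); first exact: lee_sum.
  by rewrite sumEFin lee_fin sumr_const card_ord -[K *+ _]mulr_natl ler_wpM2r.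
under eq_integral do rewrite EFinD.
rewrite ge0_integralD //; last 4 first.
- by move=> w _; rewrite lee_fin divr_ge0 ?sumr_ge0 // => *; exact: F0.
- apply/measurable_EFinP/measurable_funM => //; apply: measurable_sum => j.
  by have /measurable_EFinP := mF j.
- by move=> w _; rewrite lee_fin divr_ge0 ?exprn_ge0 ?sumr_ge0 // => *; exact: H0.
- apply/measurable_EFinP/measurable_funM => //; apply: measurable_sum => j.
  by have /measurable_EFinP := mH j.
have KF0 : 0 <= KF by rewrite mulr_ge0 ?sqr_ge0.
have KH0 : 0 <= KH by rewrite mulr_ge0 ?sqr_ge0.
rewrite (le_trans (leeD (intS F KF _ _ _ _ _ _) (intS H KH _ _ _ _ _ _))) //.
rewrite -EFinD lee_fin mulrDl; apply: lerD.
  have -> : n%:R * KF / n%:R = KF by field; rewrite gt_eqF.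
  apply: (@le_trans _ _ (27 * (2 / (c1 * (alpha * n%:R) ^+ 2) * c2 * (C * n%:R)) ^+ 2)).
    rewrite ler_wpM2l // lerXn2r ?nnegrE //; last 1 first.
    - by rewrite ler_wpM2l // mulr_ge0 // divr_ge0 // mulr_ge0 ?sqr_ge0 // ltW.
    - by rewrite mulr_ge0 // mulr_ge0 // divr_ge0 // mulr_ge0 ?sqr_ge0 // ltW.
    - by rewrite mulr_ge0 ?(mulr_ge0 (ltW C0)) // mulr_ge0 // divr_ge0 // mulr_ge0 ?sqr_ge0 // ltW.
  by rewrite le_eqVlt; apply/orP; left; apply/eqP; field; rewrite !gt_eqF.
apply: (@le_trans _ _ (n%:R * (27 * (2 * c2 * c2 * (C * n%:R)) ^+ 2) / n%:R ^+ 5)).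
  rewrite ler_wpM2r ?invr_ge0 ?exprn_ge0 // ler_wpM2l // ler_wpM2l // lerXn2r ?nnegrE ?ler_wpM2l // ?mulr_ge0 //; exact: ltW.
by rewrite le_eqVlt; apply/orP; left; apply/eqP; field; rewrite gt_eqF.
Qed.

(** Since n - p - 1 is the number of columns minus p, the difference is exactly the discrepancy over
    tr(V^2 W), minus 2 c0 + 1. *)
Lemma a_S_star_le {n p : nat} (c0 : R) (Psi : 'M[R]_p) (Y : 'M[R]_(p, n.-1)) (a kappa : R) :
  (0 < n)%N -> 0 <= c0 -> 0 < kappa ->
  kappa <= \tr (Vmat (gram Y) a *m Vmat (gram Y) a *m gram Y) ->
  `|a_S n c0 (gram Y) a - a_star Psi (gram Y) a| / n%:R <=
  `|discrepancy Y (invmx Psi) a| / n%:R / kappa + (2 * c0 + 1) / n%:R.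
Proof.
move=> n0 c00 k0; rewrite /a_S /a_star.
set V := Vmat (gram Y) a; set S := \tr (V *m V *m _) => kS.
have N0 : 0 < n%:R :> R by rewrite ltr0n.
have S0 : 0 < S by exact: lt_le_trans kS.
have nE : n%:R = n.-1%:R + 1 :> R by rewrite natr1 prednK.
have -> : ((n%:R - p%:R - 1) * \tr V + a * \tr V ^+ 2) / S - (2 * c0 + 1) -
   (\tr (invmx Psi) - a * \tr (V *m invmx Psi)) / S =
   discrepancy Y (invmx Psi) a / S - (2 * c0 + 1).
  by rewrite /discrepancy -/V nE; field; rewrite gt_eqF.
have -> : `|discrepancy Y (invmx Psi) a| / n%:R / kappa + (2 * c0 + 1) / n%:R =
    (`|discrepancy Y (invmx Psi) a| / kappa + (2 * c0 + 1)) / n%:R.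
  by field; rewrite !gt_eqF.
rewrite ler_wpM2r ?invr_ge0 ?(ltW N0) // (le_trans (ler_normB _ _)) // lerD //; last first.
  by rewrite ger0_norm // addr_ge0 // mulr_ge0.
rewrite normrM normfV (gtr0_norm S0) ler_wpM2l // lef_pV2 ?posrE //.
Qed.

End Assembly.

(** * The almost sure limit: choice of constants and of thresholds *)

Unset Implicit Arguments.

Theorem theorem4 (R : realType) (d : measure_display) (T : measurableType d)
  (P : probability T R)
  (p : nat -> nat) (Psi : forall n, 'M[R]_(p n))
  (Y : forall n, T -> 'M[R]_(p n, n.-1))
  (alphahat : forall n, 'M[R]_(p n) -> R)
  (c0 gamma c1 c2 alpha : R) (tau : forall n, 'I_(p n) -> R) (H : R -> R) :
  (forall n, posdef (Psi n)) ->
  (forall n, iid_mvnormal0_columns P (Y n) (Psi n)) ->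
  (forall n w, 0 <= alphahat n (Y n w *m (Y n w)^T)) ->
  0 <= c0 ->
  (* (A1) *)
  0 < gamma -> gamma != 1 ->
  (fun n => n%:R / (p n)%:R) @ \oo --> gamma ->
  (* (A2) *)
  (forall n, char_poly (Psi n) = \prod_(j < p n) ('X - (tau n j)%:P)) ->
  0 < c1 -> c1 <= c2 ->
  (forall n j, c1 <= tau n j <= c2) ->
  is_distribution_function H ->
  (forall t, {for t, continuous H} ->
     (fun n => esd (tau n) t) @ \oo --> H t) ->
  (* (A3) *)
  0 < alpha ->
  {ae P, forall w,
     (fun n => alphahat n (Y n w *m (Y n w)^T) / n%:R) @ \oo --> alpha} ->
  (* conclusion *)
  {ae P, forall w,
     (fun n =>
        let W := Y n w *m (Y n w)^T in
        let ah := alphahat n W in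
        `|a_S n c0 W ah - a_star (Psi n) W ah| / n%:R) @ \oo --> 0}.
Proof.
move=> pdPsi iidY _ c0_ge0 gamma_gt0 _ ngamma chPsi c1_gt0 c12 tauc _ _ alpha_gt0 cvg_alphahat.
have c2_gt0 : 0 < c2 by exact: lt_le_trans c12.
have symPsi n : (Psi n)^T = Psi n by case: (pdPsi n).
have bPsi n x : c1 * dot x x <= dot x (Psi n *m x) <= c2 * dot x x.
  exact: (quadratic_form_bounds _ _ _ _ (symPsi n) (chPsi n) (tauc n)).
(* Eventually n/p lies between gamma/2 and 2 gamma, so p/n lies between [C0] and [C]. *)
pose C := 2 / gamma; pose C0 := (2 * gamma)^-1.
have C_gt0 : 0 < C by rewrite divr_gt0.
have C0_gt0 : 0 < C0 by rewrite invr_gt0 mulr_gt0.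
have [N _ pN] : \forall n \near \oo, [/\ (1 < n)%N, (p n)%:R <= C * n%:R & C0 * n%:R <= (p n)%:R].
  have g2 : 0 < gamma / 2 by rewrite divr_gt0.
  have /cvgrPdist_lt /(_ _ g2) near_gamma := ngamma.
  near=> n.
  have : `|gamma - n%:R / (p n)%:R| < gamma / 2 by near: n.
  rewrite ltr_distl => /andP[h1 h2].
  have n1 : (1 < n)%N by near: n; exact: nbhs_infty_gt.
  have p0 : 0 < (p n)%:R :> R.
    (* If p n were 0 the ratio would be 0 by convention, at distance gamma from its limit. *)
    rewrite lt_def ler0n andbT; apply/eqP => p0; move: h1 h2.
    by rewrite p0 invr0 mulr0; lra.
  split => //.
    rewrite /C mulrAC ler_pdivlMr //.
    have : gamma / 2 < n%:R / (p n)%:R by lra.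
    by rewrite ltr_pdivlMr //; lra.
  rewrite /C0 mulrC ler_pdivrMr ?mulr_gt0 //.
  have : n%:R / (p n)%:R < 2 * gamma by lra.
  by rewrite ltr_pdivrMr //; lra.
clearbody C C0.
pose U n w := fourth_powers (Y n w) (Psi n) (invmx (Psi n)) alpha.
have U_cvg0 : {ae P, forall w, (fun n => U n w) @ \oo --> 0}.
  apply: (@ae_cvg0 _ _ _ P U (27 * (2 / (c1 * alpha ^+ 2) * c2 * C) ^+ 2 +
    27 * (2 * c2 * c2 * C) ^+ 2) N).
  - by rewrite addr_ge0 // mulr_ge0 // sqr_ge0.
  - move=> n.
    have h := @measurable_fourth_powers _ _ _ P n _ (Psi n) (Y n) c1 c2 alpha c1_gt0 (bPsi n) (iidY n) alpha_gt0.
    exact: h.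
  - move=> n w; rewrite /U /fourth_powers addr_ge0 // divr_ge0 ?exprn_ge0 //;
      by rewrite sumr_ge0 // => j _; rewrite exprn_even_ge0.
  - move=> n /pN[n1 pC _].
    have h := @exp_fourth_powers _ _ _ P n _ (Psi n) (Y n) c1 c2 alpha C (symPsi n) c1_gt0
      (ltW c2_gt0) (bPsi n) (iidY n) alpha_gt0 C_gt0 (ltnW n1) pC.
    exact: h.
apply: filterS2 U_cvg0 cvg_alphahat => w Uw aw.
(* [t0] is the bound for [\tr gram / n^2] once U <= 1, and [kappa] is the resulting lower bound for
   tr(V^2 W). *)
pose k := c1^-1; pose t0 := c2 * C + 2; pose tb := 2 * C / alpha.
pose ts := C0 / (t0 + 2 * alpha * C) * C0.
pose kappa := ts / (4 * (k + tb) * t0) * ts / (2 * (k + tb)).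
pose M := (2 * C * (1 + C) + 10 * C ^+ 2 + 2 * k * t0) / alpha ^+ 2.
have k_gt0 : 0 < k by rewrite invr_gt0.
have t0_gt0 : 0 < t0 by rewrite addr_gt0 // mulr_gt0.
have tb_gt0 : 0 < tb by rewrite divr_gt0 // mulr_gt0.
have ts_gt0 : 0 < ts by rewrite mulr_gt0 // divr_gt0 // addr_gt0 // !mulr_gt0.
have ktb_gt0 : 0 < k + tb by rewrite addr_gt0.
have kappa_gt0 : 0 < kappa.
  have d1 : 0 < 4 * (k + tb) * t0 by rewrite mulr_gt0 // mulr_gt0.
  have d2 : 0 < 2 * (k + tb) by rewrite mulr_gt0.
  exact: (divr_gt0 (mulr_gt0 (divr_gt0 ts_gt0 d1) ts_gt0) d2).
have M_ge0 : 0 <= M.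
  rewrite divr_ge0 ?sqr_ge0 // !addr_ge0 //; first by rewrite !mulr_ge0 ?addr_ge0 // ltW.
    by rewrite mulr_ge0 ?sqr_ge0.
  by rewrite !mulr_ge0 // ltW.
apply/cvgrPdist_le => /= e e_gt0.
(* The discrepancy must be at most n ts / 8 for the lower bound [kappa], and at most n kappa e / 2
   for the conclusion. It has four contributions, each allowed n e1: 1/alpha, the threshold e1, the
   fourth powers U / e1^3, and the perturbation by alphahat. In [rho], alpha / 2 keeps alphahat
   within a factor 2 of n alpha, and M + 1 avoids division by a possibly zero M. *)
pose dl := Num.min (ts / 8) (e / 2 * kappa).
have dl_gt0 : 0 < dl by rewrite lt_min !divr_gt0 //= mulr_gt0 // divr_gt0.
pose e1 := dl / 4; have e1_gt0 : 0 < e1 by rewrite divr_gt0.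
pose rho := Num.min (alpha / 2) (e1 / (M + 1)).
have rho_gt0 : 0 < rho by rewrite lt_min !divr_gt0 //= ltr_wpDl.
pose u := Num.min 1 (e1 * e1 ^+ 3).
have u_gt0 : 0 < u by rewrite lt_min ltr01 mulr_gt0 // exprn_gt0.
have /cvgrPdist_lt /(_ _ u_gt0) nearU := Uw.
have /cvgrPdist_lt /(_ _ rho_gt0) nearA := aw.
near=> n.
have nN : (N <= n)%N by near: n; exact: nbhs_infty_ge.
have [n1 pC pC0] := pN n nN.
have n_gt0 : (0 < n)%N by exact: ltnW.
have N0 : 0 < n%:R :> R by rewrite ltr0n.
have Un : `|0 - U n w| < u by near: n.
have an : `|alpha - alphahat n (Y n w *m (Y n w)^T) / n%:R| < rho by near: n.
have nbig1 : alpha^-1 / e1 <= n%:R by near: n; exact: nbhs_infty_ger.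
have nbig2 : (2 * c0 + 1) / (e / 2) <= n%:R by near: n; exact: nbhs_infty_ger.
move: an Un; rewrite -/(gram (Y n w)) sub0r normrN.
set a := alphahat n _ => an Un.
have U_le : U n w <= 1 /\ U n w <= e1 * e1 ^+ 3.
  have := le_lt_trans (ler_norm _) Un; rewrite lt_min => /andP[h1 h2].
  by split; exact: ltW.
have [an1 an2] : `|alpha - a / n%:R| < alpha / 2 /\ `|alpha - a / n%:R| < e1 / (M + 1).
  by move: an; rewrite lt_min => /andP[].
have aE : a = a / n%:R * n%:R by rewrite divfK // gt_eqF.
have a_ge : alpha * n%:R / 2 <= a.
  move: an1; rewrite ltr_distl => /andP[h1 h2]; rewrite aE mulrAC ler_wpM2r ?(ltW N0) //; lra.
have a_le : a <= 2 * (alpha * n%:R).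
  move: an1; rewrite ltr_distl => /andP[h1 h2]; rewrite aE mulrA ler_wpM2r ?(ltW N0) //; lra.
have aa0 : `|a - alpha * n%:R| = `|alpha - a / n%:R| * n%:R.
  by rewrite distrC {1}aE -mulrBl normrM (gtr0_norm N0).
have nB x : nrm (invmx (Psi n) *m x) <= k * nrm x by exact: (@nrm_invPsi _ _ (Psi n) c1 c2 c1_gt0 (bPsi n)).
have trPsi := @trace_Psi_le _ _ (Psi n) c1 c2 c1_gt0 (bPsi n).
have D0 := discrepancy_le_fourth_powers (Y n w) (Psi n) (invmx (Psi n)) alpha n_gt0 alpha_gt0 e1 e1_gt0.
have trW : \tr (gram (Y n w)) <= n%:R ^+ 2 * t0.
  have := trace_gram_le (Y n w) (Psi n) (invmx (Psi n)) c2 C alpha n_gt0 (ltW c2_gt0) C_gt0 pC trPsi.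
  move=> /le_trans; apply; rewrite ler_wpM2l ?sqr_ge0 // /t0 -addrA lerD2l.
  by have := U_le.1; rewrite /U; lra.
have DD := discrepancy_perturb (Y n w) (invmx (Psi n)) k C alpha n_gt0 (ltW k_gt0) C_gt0 alpha_gt0 pC nB a t0 a_ge trW.
have Dn : `|discrepancy (Y n w) (invmx (Psi n)) a| <= n%:R * dl.
  rewrite -[X in `|X|](subrK (discrepancy (Y n w) (invmx (Psi n)) (alpha * n%:R))).
  rewrite (le_trans (ler_normD _ _)) // (le_trans (lerD DD D0)) // -/M aa0.
  have h1 : alpha^-1 <= n%:R * e1 by rewrite -ler_pdivrMr.
  have h2 : n%:R * (U n w / e1 ^+ 3) <= n%:R * e1.
    by rewrite ler_wpM2l ?(ltW N0) // ler_pdivrMr ?exprn_gt0 //; exact: U_le.2.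
  have h3 : `|alpha - a / n%:R| * n%:R * M <= n%:R * e1.
    rewrite mulrAC mulrC ler_wpM2l ?(ltW N0) //.
    have M1 : 0 < M + 1 by rewrite ltr_wpDl.
    move: an2; rewrite ltr_pdivlMr // mulrDr mulr1 => an2.
    by have := normr_ge0 (alpha - a / n%:R); lra.
  have -> : dl = e1 + e1 + e1 + e1 by rewrite /e1; field.
  by rewrite -/(U n w) !mulrDr; lra.
have S_ge : kappa <= \tr (Vmat (gram (Y n w)) a *m Vmat (gram (Y n w)) a *m gram (Y n w)).
  apply: (trace_sqr_lower_bound (Y n w) (invmx (Psi n)) k C alpha n_gt0 (ltW k_gt0) C_gt0 alpha_gt0 pC nB a t0 a_ge trW C0 C0_gt0 pC0) => //.
  by rewrite (le_trans Dn) // ler_wpM2l ?(ltW N0) // ge_min lexx.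
rewrite sub0r normrN ger0_norm; last by rewrite divr_ge0.
rewrite (le_trans (a_S_star_le c0 (Psi n) (Y n w) a kappa n_gt0 c0_ge0 kappa_gt0 S_ge)) //.
have -> : e = e / 2 + e / 2 by field.
apply: lerD; last first.
  have e2_gt0 : 0 < e / 2 by rewrite divr_gt0.
  by rewrite ler_pdivrMr // [leRHS]mulrC -ler_pdivrMr.
rewrite ler_pdivrMr // ler_pdivrMr // (le_trans Dn) // mulrC ler_wpM2r ?(ltW N0) //.
by rewrite ge_min lexx orbT.
Unshelve. all: by end_near. Qed.
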